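(* Let $n\ge 9$ and let $L$ be an $n$-dimensional naturally graded complex Leibniz algebra with characteristic sequence $(n-3,3)$ of the first type. Then $L$ is isomorphic to one of the following pairwise non-isomorphic algebras, each given on a basis $e_1,\dots,e_n$ (products of basis vectors not listed are zero; in every case $[e_i,e_1]=e_{i+1}$ for $1\le i\le n-1$, $i\ne n-3$): - $L^{34}_{(0,\lambda,0)}$, $\lambda\in\mathbb{C}$: additionally $[e_1,e_{n-2}]=\lambda e_{n-1}$, $[e_2,e_{n-2}]=\lambda e_n$. - $L^{35}_{(\mu,\lambda,1)}$, $\lambda,\mu\in\{0,1\}$: additionally $[e_1,e_{n-2}]=\mu e_2+\lambda e_{n-1}$, $[e_2,e_{n-2}]=\mu e_3+\lambda e_n$, $[e_i,e_{n-2}]=\mu e_{i+1}$ for $3\le i\le n-4$, $[e_i,e_{n-2}]=e_{i+1}$ for $n-2\le i\le n-1$. - $L^{36}_{(1,\lambda,0)}$, $\lambda\in\{-1,0\}$: additionally $[e_1,e_{n-2}]=e_2+\lambda e_{n-1}$, $[e_2,e_{n-2}]=e_3+\lambda e_n$, $[e_i,e_{n-2}]=e_{i+1}$ for $3\le i\le n-4$. - $L^{37}_{(1,\lambda,2)}$, $\lambda\in\mathbb{C}$: additionally $[e_1,e_{n-2}]=e_2+\lambda e_{n-1}$, $[e_2,e_{n-2}]=e_3+\lambda e_n$, $[e_i,e_{n-2}]=e_{i+1}$ for $3\le i\le n-4$, $[e_i,e_{n-2}]=2e_{i+1}$ for $n-2\le i\le n-1$. - $L^{38}_{(0,0,\lambda)}$,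 $\lambda\in\mathbb{C}$: additionally $[e_1,e_{n-2}]=-e_{n-1}$, $[e_2,e_{n-2}]=-(1+\lambda)e_n$, $[e_1,e_{n-1}]=\lambda e_n$. - $L^{39}_{(0,1,\lambda)}$, $\lambda\in\{-1,0\}$: additionally $[e_1,e_{n-2}]=-e_{n-1}$, $[e_2,e_{n-2}]=-(1+\lambda)e_n$, $[e_{n-1},e_{n-2}]=-e_n$, $[e_1,e_{n-1}]=\lambda e_n$, $[e_{n-2},e_{n-1}]=e_n$. - $L^{40}_{(1,\lambda,\mu)}$, $\lambda\in\{0,1\}$, $\mu\in\mathbb{C}$: additionally $[e_1,e_{n-2}]=e_2-e_{n-1}$, $[e_2,e_{n-2}]=e_3-(1+\mu)e_n$, $[e_i,e_{n-2}]=e_{i+1}$ for $3\le i\le n-4$, $[e_{n-1},e_{n-2}]=-\lambda e_n$, $[e_1,e_{n-1}]=\mu e_n$, $[e_{n-2},e_{n-1}]=\lambda e_n$. - $L^{41}_{(1,-1,\lambda)}$, $\lambda\in\{-1,0\}$: additionally $[e_1,e_{n-2}]=e_2-e_{n-1}$, $[e_2,e_{n-2}]=e_3-(1+\lambda)e_n$, $[e_i,e_{n-2}]=e_{i+1}$ for $3\le i\le n-4$, $[e_{n-1},e_{n-2}]=e_n$, $[e_1,e_{n-1}]=\lambda e_n$, $[e_{n-2},e_{n-1}]=-e_n$.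
   Context: All algebras are finite-dimensional over $\mathbb{C}$. A Leibniz algebra is a vector space $L$ with a bilinear bracket satisfying $[x,[y,z]]=[[x,y],z]-[[x,z],y]$ for all $x,y,z$. Put $L^1=L$, $L^{k+1}=[L^k,L]$; $L$ is nilpotent if $L^s=0$ for some $s$, and the least such $s$ is its nilindex. For $L$ nilpotent of nilindex $s$, let $L_i=L^i/L^{i+1}$ ($1\le i\le s-1$) and $\mathrm{gr}\,L=L_1\oplus\dots\oplus L_{s-1}$, a graded Leibniz algebra with the induced bracket $[L_i,L_j]\subseteq L_{i+j}$; $L$ is naturally graded if $L\cong \mathrm{gr}\,L$. For $x\in L\setminus L^2$, $R_x$ denotes the nilpotent right multiplication operator $R_x(y)=[y,x]$, and $C(x)$ is the decreasing sequence of the dimensions of its Jordan blocks. The characteristic sequence of $L$ is the maximum of $C(x)$ over $x\in L\setminus L^2$ in the lexicographic order. First type. An $n$-dimensional naturally graded Leibniz algebra $L$ with characteristic sequence $(n-3,3)$ is of the first type if there is a basis $\{e_1,\dots,e_n\}$ of $L$ with $e_1\in L\setminus L^2$ such that in this basis $R_{e_1}=\mathrm{diag}(J_{n-3},J_3)$, where $J_k$ is the nilpotent Jordan block of size $k$ sending each basis vector of its block to the next one and the last to $0$; that is, $[e_i,e_1]=e_{i+1}$ for $1\le i\le n-1$, $i\neq n-3$, and $[e_{n-3},e_1]=[e_n,e_1]=0$.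
   Formalization: The list repeats two algebras: L^{34}_{(0,-1,0)} = L^{38}_{(0,0,0)} and L^{36}_{(1,-1,0)} = L^{40}_{(1,0,0)} have identical tables; ''pairwise non-isomorphic'' is proved for listed algebras whose multiplication tables differ. *)

(* Defs.v *)
From HB Require Import structures.
From mathcomp Require Import all_boot all_order all_algebra.
From mathcomp Require Import zify ring.

Set Implicit Arguments.
Unset Strict Implicit.
Unset Printing Implicit Defensive.

Import GRing.Theory.
Local Open Scope ring_scope.

Definition alg_iso (F : fieldType) (V W : lmodType F)
    (b : V -> V -> V) (c : W -> W -> W) : Prop :=
  exists f : {linear V -> W}, bijective f /\ forall x y, f (b x y) = c (f x) (f y).

Section DirectSum.
Variables (F : fieldType) (I : finType) (T : I -> vectType F).

Definition dsum := {dffun forall i, T i}.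
HB.instance Definition _ := Choice.on dsum.

Definition dsum_zero : dsum := [ffun i => 0].
Definition dsum_opp (u : dsum) : dsum := [ffun i => - u i].
Definition dsum_add (u v : dsum) : dsum := [ffun i => u i + v i].
Definition dsum_scale (a : F) (u : dsum) : dsum := [ffun i => a *: u i].

Fact dsum_addA : associative dsum_add.
Proof. by move=> u v w; apply/ffunP => i; rewrite !ffunE addrA. Qed.
Fact dsum_addC : commutative dsum_add.
Proof. by move=> u v; apply/ffunP => i; rewrite !ffunE addrC. Qed.
Fact dsum_add0 : left_id dsum_zero dsum_add.
Proof. by move=> u; apply/ffunP => i; rewrite !ffunE add0r. Qed.
Fact dsum_addN : left_inverse dsum_zero dsum_opp dsum_add.
Proof. by move=> u; apply/ffunP => i; rewrite !ffunE addNr. Qed.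
HB.instance Definition _ :=
  GRing.isZmodule.Build dsum dsum_addA dsum_addC dsum_add0 dsum_addN.

Fact dsum_scaleA a b (u : dsum) :
  dsum_scale a (dsum_scale b u) = dsum_scale (a * b) u.
Proof. by apply/ffunP => i; rewrite !ffunE scalerA. Qed.
Fact dsum_scale1 : left_id 1 dsum_scale.
Proof. by move=> u; apply/ffunP => i; rewrite !ffunE scale1r. Qed.
Fact dsum_scaleDr : right_distributive dsum_scale +%R.
Proof. by move=> a u v; apply/ffunP => i; rewrite !ffunE scalerDr. Qed.
Fact dsum_scaleDl (u : dsum) : {morph dsum_scale^~ u : a b / a + b}.
Proof. by move=> a b; apply/ffunP => i; rewrite !ffunE scalerDl. Qed.
HB.instance Definition _ := GRing.Zmodule_isLmodule.Build F dsum
  dsum_scaleA dsum_scale1 dsum_scaleDr dsum_scaleDl.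

Lemma dsum_addE (u v : dsum) i : (u + v) i = u i + v i.
Proof. by rewrite ffunE. Qed.
Lemma dsum_scaleE a (u : dsum) i : (a *: u) i = a *: u i.
Proof. by rewrite ffunE. Qed.
Lemma dsum_zeroE i : (0 : dsum) i = 0.
Proof. by rewrite ffunE. Qed.

End DirectSum.

(* The quotient U / W (for W <= U), carried by the complement U :\: W of W in U;
   quot_mapK, quot_map_eq0 and quot_repr_sub show that quot_map restricted to U
   is onto with kernel W, quot_repr picking a representative of each coset. *)
Section Quotient.
Variables (F : fieldType) (V : vectType F) (U W : {vspace V}).

Definition quot : vectType F := subvs_of (U :\: W)%VS.
Definition quot_map : V -> quot := vsproj (U :\: W) \o addv_pi1 U W.
Definition quot_repr (q : quot) : V := vsval q.

Fact quot_map_linear : linear quot_map.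
Proof. by move=> a x y; rewrite /quot_map /= linearP linearP. Qed.
HB.instance Definition _ :=
  GRing.isLinear.Build F V quot _ quot_map quot_map_linear.

HB.instance Definition _ := GRing.Linear.copy quot_repr (@vsval F V (U :\: W)).

Lemma quot_repr_mem q : quot_repr q \in U.
Proof. exact: (subvP (diffvSl U W)) (subvsP q). Qed.

Lemma quot_mapK : cancel quot_repr quot_map.
Proof.
move=> q; rewrite /quot_map /quot_repr /= /addv_pi1 daddv_pi_id ?subvsP //.
  exact: vsvalK.
by rewrite capv_diff.
Qed.

Lemma quot_repr_sub x : x \in U -> quot_repr (quot_map x) - x \in W.
Proof.
move=> xU; rewrite /quot_repr /quot_map /= vsprojK ?memv_pi //.
have xUW : x \in (U + W)%VS by rewrite (subvP (addvSl _ _)).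
by rewrite -{2}(addv_pi1_pi2 xUW) opprD addNKr memvN memv_pi2.
Qed.

Lemma quot_map_eq0 x : (W <= U)%VS -> x \in U -> (quot_map x == 0) = (x \in W).
Proof.
move=> WU xU; have h := quot_repr_sub xU; apply/eqP/idP => [q0|xW].
  by move: h; rewrite q0 linear0 sub0r memvN.
have rW : quot_repr (quot_map x) \in W by rewrite -(subrK x (quot_repr _)) memvD.
rewrite -(quot_mapK (quot_map x)); suff -> : quot_repr (quot_map x) = 0 by rewrite linear0.
by apply/eqP; rewrite -memv0 -(capv_diff U W) memv_cap rW subvsP.
Qed.

End Quotient.

Section LeibnizAlgebra.
Variables (F : fieldType) (V : vectType F) (br : {bilinear V -> V -> V}).

Definition leibniz : Prop :=
  forall x y z, br x (br y z) = br (br x y) z - br (br x z) y.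

(* The span [U, W] of all brackets (see memv_brv and brv_subP). *)
Definition brv (U W : {vspace V}) : {vspace V} :=
  <<[seq br x y | x <- vbasis U, y <- vbasis W]>>%VS.

(* lcs k = L^k for 1 <= k; the value at 0 is never used. *)
Definition lcs (k : nat) : {vspace V} := iter k.-1 (brv^~ fullv) fullv.

Definition nilindex (s : nat) : Prop :=
  [/\ (0 < s)%N, lcs s = 0%VS & forall k, (0 < k < s)%N -> lcs k <> 0%VS].

(* The index i : 'I_s.-1 stands for the degree i.+1. *)
Definition gr_piece (i : nat) : vectType F := quot (lcs i.+1) (lcs i.+2).
Definition gr (s : nat) : lmodType F := dsum (fun i : 'I_s.-1 => gr_piece i).

Definition gr_bracket (s : nat) (u v : gr s) : gr s :=
  [ffun k : 'I_s.-1 =>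
    \sum_(i < s.-1) \sum_(j < s.-1 | (i.+1 + j.+1 == k.+1)%N)
      quot_map (lcs k.+1) (lcs k.+2) (br (quot_repr (u i)) (quot_repr (v j)))].

Definition naturally_graded : Prop :=
  exists s, nilindex s /\ alg_iso br (@gr_bracket s).

(* f is nilpotent and has Jordan blocks of sizes s: V has a basis made of chains
   v, f v, ..., f^(k-1) v with f^k v = 0, one of length k for each k in s. *)
Definition jordan_sizes (f : V -> V) (s : seq nat) : Prop :=
  [/\ sorted geq s, all (leq 1) s &
    exists vs : seq V,
      [/\ size vs = size s,
          basis_of fullv (flatten [seq traject f p.1 p.2 | p <- zip vs s]) &
          all (fun p => iter p.2 f p.1 == 0) (zip vs s)]].

Definition rmul (x : V) : V -> V := fun y => br y x.

Definition charseq (s : seq nat) : Prop :=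
  (exists2 x, x \notin lcs 2 & jordan_sizes (rmul x) s) /\
  (forall x t, x \notin lcs 2 -> jordan_sizes (rmul x) t ->
     ((t : seqlexi nat) <= s)%O).

(* The basis is e 1, ..., e n. *)
Definition first_type (n : nat) : Prop :=
  exists e : nat -> V,
    [/\ basis_of fullv [seq e i | i <- iota 1 n],
        e 1%N \notin lcs 2,
        forall i, (1 <= i <= n - 1)%N -> i <> (n - 3)%N -> br (e i) (e 1%N) = e i.+1,
        br (e (n - 3)%N) (e 1%N) = 0 & br (e n) (e 1%N) = 0].

Lemma memv_brv (U W : {vspace V}) x y : x \in U -> y \in W -> br x y \in brv U W.
Proof.
move=> xU yW; rewrite (coord_vbasis xU) (coord_vbasis yW) linear_sumlz.
apply: memv_suml => i _; rewrite linear_sumr; apply: memv_suml => j _.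
rewrite linearZl_LR linearZr_LR; do 2!apply: memvZ.
by apply: memv_span; apply: allpairs_f; apply: mem_nth; rewrite size_tuple.
Qed.

Lemma brv_sub (U W X : {vspace V}) :
  (forall x y, x \in U -> y \in W -> br x y \in X) -> (brv U W <= X)%VS.
Proof.
move=> h; apply/span_subvP => _ /allpairsP[[x y] /= [xU yW ->]].
by apply: h; apply: vbasis_mem.
Qed.

Lemma lcsS k : lcs k.+2 = brv (lcs k.+1) fullv.
Proof. by []. Qed.

Lemma memv_lcsS k x y : x \in lcs k.+1 -> br x y \in lcs k.+2.
Proof. by move=> xk; apply: memv_brv => //; apply: memvf. Qed.

Lemma lcs_sub k : (lcs k.+2 <= lcs k.+1)%VS.
Proof.
elim: k => [|k IH]; first exact: subvf.
by rewrite lcsS; apply: brv_sub => x y xk _; apply/memv_lcsS/(subvP IH).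
Qed.

Lemma memv_lcsD i j x y : leibniz ->
  x \in lcs i.+1 -> y \in lcs j.+1 -> br x y \in lcs (i.+1 + j.+1).
Proof.
move=> L; elim: j i x y => [|j IH] i x y xi yj.
  by rewrite addn1; apply: memv_lcsS.
have: y \in <<in_tuple [seq br a b | a <- vbasis (lcs j.+1), b <- vbasis fullv]>>%VS.
  exact: yj.
move/coord_span->; rewrite linear_sumr; apply: memv_suml => k _.
rewrite linearZr_LR memvZ //.
have /allpairsP[[a b] /= [aj _ ->]] := mem_nth 0 (ltn_ord k).
have {}aj := vbasis_mem aj.
have -> : (i.+1 + j.+2 = (i.+1 + j).+2)%N by lia.
rewrite L memvB //; first by apply: memv_lcsS; rewrite -addnS IH.
by have := IH _ _ _ (memv_lcsS b xi) aj; rewrite addnS.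
Qed.

(* The bracket of gr does not depend on the representatives. *)
Lemma gr_bracketE s (x y : 'I_s.-1 -> V) : leibniz ->
    (forall i, x i \in lcs i.+1) -> (forall i, y i \in lcs i.+1) ->
  @gr_bracket s [ffun i : 'I_s.-1 => quot_map (lcs i.+1) (lcs i.+2) (x i)]
                [ffun j : 'I_s.-1 => quot_map (lcs j.+1) (lcs j.+2) (y j)] =
  [ffun k : 'I_s.-1 =>
    \sum_(i < s.-1) \sum_(j < s.-1 | (i.+1 + j.+1 == k.+1)%N)
      quot_map (lcs k.+1) (lcs k.+2) (br (x i) (y j))].
Proof.
move=> L xP yP; apply/ffunP => k; rewrite !ffunE.
apply: eq_bigr => i _; apply: eq_bigr => j /eqP ijk; rewrite !ffunE.
set a := quot_repr _; set b := quot_repr _.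
have ax : a - x i \in lcs i.+2 by apply: quot_repr_sub.
have yb : b - y j \in lcs j.+2 by apply: quot_repr_sub.
have aP : a \in lcs i.+1 by apply: quot_repr_mem.
apply/eqP; rewrite -subr_eq0 -linearB.
have -> : br a b - br (x i) (y j) = br (a - x i) (y j) + br a (b - y j).
  by rewrite linearBl linearBr [RHS]addrC addrA subrK.
have kP t : t \in lcs k.+2 -> t \in lcs k.+1 by apply/subvP/lcs_sub.
have h : br (a - x i) (y j) + br a (b - y j) \in lcs k.+2.
  rewrite -ijk memvD //; first exact: memv_lcsD ax (yP j).
  by rewrite -addnS; apply: memv_lcsD aP yb.
by rewrite quot_map_eq0 ?kP //; apply: lcs_sub.
Qed.

End LeibnizAlgebra.

Inductive listed (F : Type) :=
| L34 (lambda : F)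
| L35 (mu lambda : F)
| L36 (lambda : F)
| L37 (lambda : F)
| L38 (lambda : F)
| L39 (lambda : F)
| L40 (lambda mu : F)
| L41 (lambda : F).

Section Listed.
Variables (F : fieldType) (n : nat).

Definition admissible (t : listed F) : Prop :=
  match t with
  | L34 _ | L37 _ | L38 _ => True
  | L35 mu l => mu \in [:: 0; 1] /\ l \in [:: 0; 1]
  | L36 l | L39 l | L41 l => l \in [:: -1; 0]
  | L40 l _ => l \in [:: 0; 1]
  end.

(* e_ k is the basis vector e_k, with k counted from 1. *)
Definition e_ (k : nat) : 'rV[F]_n := \row_(j < n) (j.+1 == k)%:R.

(* table t i j is the product [e_i, e_j], for 1 <= i, j <= n. *)
Definition table (t : listed F) (i j : nat) : 'rV[F]_n :=
  if j == 1%N then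
    if (1 <= i <= n - 1)%N && (i != n - 3)%N then e_ i.+1 else 0
  else match t with
  | L34 l =>
      if j == (n - 2)%N then
        if i == 1%N then l *: e_ (n - 1)
        else if i == 2%N then l *: e_ n
        else 0
      else 0
  | L35 mu l =>
      if j == (n - 2)%N then
        if i == 1%N then mu *: e_ 2 + l *: e_ (n - 1)
        else if i == 2%N then mu *: e_ 3 + l *: e_ n
        else if (3 <= i <= n - 4)%N then mu *: e_ i.+1
        else if (n - 2 <= i <= n - 1)%N then e_ i.+1
        else 0
      else 0
  | L36 l =>
      if j == (n - 2)%N then
        if i == 1%N then e_ 2 + l *: e_ (n - 1)
        else if i == 2%N then e_ 3 + l *: e_ n
        else if (3 <= i <= n - 4)%N then e_ i.+1
        else 0
      else 0
  | L37 l =>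
      if j == (n - 2)%N then
        if i == 1%N then e_ 2 + l *: e_ (n - 1)
        else if i == 2%N then e_ 3 + l *: e_ n
        else if (3 <= i <= n - 4)%N then e_ i.+1
        else if (n - 2 <= i <= n - 1)%N then 2 *: e_ i.+1
        else 0
      else 0
  | L38 l =>
      if j == (n - 2)%N then
        if i == 1%N then - e_ (n - 1)
        else if i == 2%N then - (1 + l) *: e_ n
        else 0
      else if j == (n - 1)%N then
        if i == 1%N then l *: e_ n
        else 0
      else 0
  | L39 l =>
      if j == (n - 2)%N then
        if i == 1%N then - e_ (n - 1)
        else if i == 2%N then - (1 + l) *: e_ n
        else if i == (n - 1)%N then - e_ n
        else 0
      else if j == (n - 1)%N then
        if i == 1%N then l *: e_ n
        else if i == (n - 2)%N then e_ n
        else 0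
      else 0
  | L40 l mu =>
      if j == (n - 2)%N then
        if i == 1%N then e_ 2 - e_ (n - 1)
        else if i == 2%N then e_ 3 - (1 + mu) *: e_ n
        else if (3 <= i <= n - 4)%N then e_ i.+1
        else if i == (n - 1)%N then - l *: e_ n
        else 0
      else if j == (n - 1)%N then
        if i == 1%N then mu *: e_ n
        else if i == (n - 2)%N then l *: e_ n
        else 0
      else 0
  | L41 l =>
      if j == (n - 2)%N then
        if i == 1%N then e_ 2 - e_ (n - 1)
        else if i == 2%N then e_ 3 - (1 + l) *: e_ n
        else if (3 <= i <= n - 4)%N then e_ i.+1
        else if i == (n - 1)%N then e_ n
        else 0
      else if j == (n - 1)%N then
        if i == 1%N then l *: e_ n
        else if i == (n - 2)%N then - e_ n
        else 0
      else 0
  end.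

Definition listed_bracket (t : listed F) (x y : 'rV[F]_n) : 'rV[F]_n :=
  \sum_(i < n) \sum_(j < n) (x 0 i * y 0 j) *: table t i.+1 j.+1.

Definition same_algebra (t t' : listed F) : Prop :=
  forall x y, listed_bracket t x y = listed_bracket t' x y.

Lemma listed_bracketE t i j : (1 <= i <= n)%N -> (1 <= j <= n)%N ->
  listed_bracket t (e_ i) (e_ j) = table t i j.
Proof.
case: i => // i; case: j => // j /= iN jN; rewrite /listed_bracket.
rewrite (bigD1 (Ordinal iN)) //= (bigD1 (Ordinal jN)) //= !mxE !eqxx mulr1 scale1r.
rewrite [X in _ + X + _]big1 => [|b /negP jb]; last first.
  rewrite !mxE; case: eqP => [[bE]|_]; last by rewrite mulr0 scale0r.
  by case: jb; apply/eqP/val_inj.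
rewrite [X in _ + X]big1 ?addr0 // => a /negP ia.
rewrite big1 // => b _; rewrite !mxE; case: eqP => [[aE]|_].
  by case: ia; apply/eqP/val_inj.
by rewrite mul0r scale0r.
Qed.

End Listed.

(* The parametrization repeats exactly two algebras: L34 (-1) and L38 0 have the
   same table, and so do L36 (-1) and L40 0 0. *)
Definition twin (F : fieldType) (t t' : listed F) : Prop :=
  match t, t' with
  | L34 l, L38 l' | L38 l', L34 l => l = -1 /\ l' = 0
  | L36 l, L40 l' mu | L40 l' mu, L36 l => [/\ l = -1, l' = 0 & mu = 0]
  | _, _ => False
  end.

(* The coefficients of [e_1, e_(n-2)] on e_2 and e_(n-1), of [e_(n-2), e_(n-2)] on
   e_(n-1), of [e_(n-1), e_(n-2)] on e_n and of [e_1, e_(n-1)] on e_n. *)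
Definition coefficients (F : fieldType) (t : listed F) : F * F * F * F * F :=
  match t with
  | L34 l => (0, l, 0, 0, 0)
  | L35 mu l => (mu, l, 1, 1, 0)
  | L36 l => (1, l, 0, 0, 0)
  | L37 l => (1, l, 2, 2, 0)
  | L38 l => (0, -1, 0, 0, l)
  | L39 l => (0, -1, 0, -1, l)
  | L40 l mu => (1, -1, 0, - l, mu)
  | L41 l => (1, -1, 0, 1, l)
  end.

Lemma coefficientsE (F : fieldType) (n : nat) (t : listed F) (k2 k k' : 'I_n) :
  (9 <= n)%N -> val k2 = 1%N -> val k = (n - 2)%N -> val k' = (n - 1)%N ->
  (table n t 1 (n - 2) 0 k2, table n t 1 (n - 2) 0 k,
   table n t (n - 2) (n - 2) 0 k, table n t (n - 1) (n - 2) 0 k',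
   table n t 1 (n - 1) 0 k') = coefficients t.
Proof.
move=> n9 h2 hk hk'.
case: t => [l|mu l|l|l|l|l|l mu|l]; rewrite /table /=.
all: repeat match goal with |- context [if ?b then _ else _] =>
  first [have -> : b = true by lia | have -> : b = false by lia] end.
all: rewrite !mxE; rewrite /= ?h2 ?hk ?hk'.
all: repeat match goal with |- context [nat_of_bool ?b] =>
  first [have -> : b = true by lia | have -> : b = false by lia] end.
all: by rewrite ?mulr0 ?mulr1 ?oppr0 ?addr0 ?add0r ?sub0r ?mulr1n.
Qed.

Lemma same_algebraP (F : numFieldType) (n : nat) (t t' : listed F) :
  (9 <= n)%N -> admissible t -> admissible t' ->
  same_algebra n t t' <-> t = t' \/ twin t t'.
Proof.
move=> n9 a a'; split; last first.
  case=> [-> //|tw] x y; rewrite /listed_bracket.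
  apply: eq_bigr => i _; apply: eq_bigr => j _; congr (_ *: _).
  move: tw {a a'}; case: t => [l|mu l|l|l|l|l|l mu|l];
    case: t' => [l'|mu' l'|l'|l'|l'|l'|l' mu'|l'] //= => -[-> ->]; try move=> ->;
    rewrite /table; do !case: ifP => // _;
    by rewrite ?addr0 ?oppr0 ?scaleN1r ?scale1r ?scale0r.
move=> h.
have {}h i j : (1 <= i <= n)%N -> (1 <= j <= n)%N -> table n t i j = table n t' i j.
  by move=> iN jN; rewrite -!listed_bracketE.
have o2 : (1 < n)%N by lia.
have o7 : (n - 2 < n)%N by lia.
have o8 : (n - 1 < n)%N by lia.
have E := @coefficientsE F n _ (Ordinal o2) (Ordinal o7) (Ordinal o8) n9 erefl erefl erefl.
have {E h} : coefficients t = coefficients t'.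
  by rewrite -(E t) -(E t'); do ![congr (_, _)]; rewrite h //; lia.
have n20 : (2 == 0 :> F) = false by rewrite Num.Theory.pnatr_eq0.
have n10 : (1 == 0 :> F) = false by rewrite oner_eq0.
have n21 : (2 == 1 :> F) = false by rewrite -subr_eq0 -[2]/(1 + 1) addrK.
have n1N : (1 == -1 :> F) = false by rewrite -addr_eq0.
have nN0 : (-1 == 0 :> F) = false by rewrite oppr_eq0.
case: t a => [l|mu l|l|l|l|l|l mu|l]; case: t' a' => [l'|mu' l'|l'|l'|l'|l'|l' mu'|l'] /=;
  rewrite ?inE => a' a; repeat match goal with
  | H : _ /\ _ |- _ => case: H => ? ?
  | H : is_true (_ || _) |- _ => case/orP: H => /eqP ?
  end; subst; move/eqP; rewrite !xpair_eqE ?eqxx ?(eq_sym 0 2) ?(eq_sym 0 1)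
    ?(eq_sym 1 2) ?(eq_sym (-1) 1) ?(eq_sym 0 (-1)) ?oppr0 ?n20 ?n10 ?n21
    ?n1N ?nN0 ?andbF ?andbT //=.
all: try by left.
all: move=> H; repeat match goal with E : is_true (_ && _) |- _ =>
  case/andP: E => ? ? end.
all: repeat match goal with E : is_true (?x == ?y) |- _ =>
  move/eqP: E => E; try (subst x) end; try subst; 
  try by [left | right].
all: match goal with E : 0 = _ |- _ =>
  by move/eqP: E; rewrite eq_sym ?nN0 ?n10 end.
Qed.

(* Main.v *)
Require Import Defs.
From HB Require Import structures.
From mathcomp Require Import all_boot all_order all_algebra.
From mathcomp Require Import reals complex.
From mathcomp Require Import zify ring.
Import GRing.Theory.
Local Open Scope ring_scope.

(** Notation: a b is the bracket, products associate to the left, [R_a] is right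
    multiplication by [a].  The Leibniz identity a(bc) = (ab)c - (ac)b says that
    right multiplication by a product is a commutator of right multiplications;
    hence z(aa) = 0 and z(ab + ba) = 0 for all z.  The elements a with z a = 0 for all z
    ([rann]) form an ideal.

    Existence.  An isomorphism between L and gr L makes L itself graded, with pieces A_1, A_2, ... such that A_(k+1) = A_k A_1
    ([naturally_graded_grading]).  Let x and y be the degree one parts of e_1 and
    e_(n-2), and u = yx, v = ux.  The main step, [first_type_chains], is that
    x, xx, xxx, ... (n - 3 terms) together with y, u, v is again a basis, so that e_1
    and e_(n-2) may be taken homogeneous.  Two facts feed it: R_(e_1) has a kernel of
    dimension 2, so that it maps the elements of degree >= k onto those of degree
    >= k + 1 as soon as the piece A_k has dimension 2; and if e_i lies in
    degrees >= m, then e_(n-3), which is not zero, lies in degrees >= m + n - 3 - i,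
    which makes many pieces nonzero, while their dimensions add up to n.  When u is in
    [rann], R_x and R_y commute and A_(k+1) = A_k x at once.  Otherwise xx is nonzero
    ([square_neq0]), A_1 and A_2 have dimension 2, A_3 = A_2 x, and A_3 can be
    neither the line of xxx ([long_line_absurd]) nor at most the line of v with
    xxx = 0 ([short_line_absurd]); the remaining pieces are then lines.

    On such a basis everything is determined by R_x, known, and R_y, homogeneous of
    degree one; the Leibniz identity leaves five scalars al, be, be2, d, mu
    ([adapted]), with d = be2 and mu = 0 when u is in [rann], and with be = -1 and
    be2 = 0 otherwise ([graded_chains_adapted]).  These are exactly the scalars that
    [coefficients] reads off a listed algebra.  Replacing x, y by A x + B y, Q y changes
    them by the fractional linear rule [coeff_change]: the numbers 1/al, 1/be2, 1/d
    undergo the common affine map z -> (A z + B) / Q.  Elementary choices of A, B, Q reach a listed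
    tuple ([exists_listed_coeff]); one of them takes a square root.

    Conversely, an isomorphism f between two listed algebras provides A, B, Q, the
    leading coordinates of f(e_1) and f(e_(n-2)), for which the two tuples of
    coefficients are again related by [coeff_change] ([iso_coeff_change]); on
    listed tuples this relation is equality ([normal_coeff_rigid]), and the tuple determines
    the table. *)

Set Implicit Arguments.
Unset Strict Implicit.
Unset Printing Implicit Defensive.

(** * The grading carried by a naturally graded algebra *)

Lemma dsum_sumE (F : fieldType) (I : finType) (T : I -> vectType F) (J : Type)
    (r : seq J) (E : J -> dsum T) i : (\sum_(j <- r) E j) i = \sum_(j <- r) E j i.
Proof. exact: (big_morph (fun u : dsum T => u i) (fun u w => dsum_addE u w i) (dsum_zeroE T i)). Qed.

Section Grading.
Context {F : fieldType} {V : vectType F} (br : {bilinear V -> V -> V}).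

(** A grading is given by its projections [pr k] rather than by subspaces, so that
    components of products can be computed in [V].  The last clause says that
    degree one generates; it makes the lower central series the degree filtration. *)
Definition graded_by (s : nat) (pr : nat -> 'End(V)) : Prop :=
  [/\ forall z, z = \sum_(k < s) pr k z,
      forall k l z, pr k (pr l z) = if k == l then pr k z else 0,
      forall z, pr 0%N z = 0,
      forall k a b, pr k (br a b) = \sum_(i < k.+1) br (pr i a) (pr (k - i)%N b)
    & forall k z, pr k.+2 z \in brv br (limg (pr k.+1)) (limg (pr 1%N))].

Section FromGr.
Context {s : nat} (leib : leibniz br).
Context (g : {linear V -> gr br s}) (h : gr br s -> V).
Hypotheses (gK : cancel g h) (hK : cancel h g).
Hypothesis gM : forall a b, g (br a b) = gr_bracket (g a) (g b).

Definition degree_comp (k : nat) (u : gr br s) : gr br s :=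
  [ffun i : 'I_s.-1 => if i.+1 == k then u i else 0].

Definition degree_part (k : nat) (z : V) : V := h (degree_comp k (g z)).

Fact degree_part_linear k : linear (degree_part k).
Proof.
move=> a x y; apply: (can_inj gK); rewrite linearP !hK linearP.
apply/ffunP => i; rewrite !ffunE.
by case: ifP => // _; rewrite scaler0 addr0.
Qed.
HB.instance Definition _ k :=
  GRing.isLinear.Build F V V _ (degree_part k) (degree_part_linear k).

Lemma degree_comp_bracket k (u w : gr br s) :
  degree_comp k (gr_bracket u w) =
  \sum_(i < k.+1) gr_bracket (degree_comp i u) (degree_comp (k - i) w).
Proof.
apply/ffunP => m; rewrite dsum_sumE !ffunE.
rewrite [RHS](eq_bigr (fun p : 'I_k.+1 => \sum_(i < s.-1) \sum_(j < s.-1 | (i.+1 + j.+1 == m.+1)%N)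
   if (i.+1 == p) && (j.+1 == k - p)%N then quot_map (lcs br m.+1) (lcs br m.+2)
     (br (quot_repr (u i)) (quot_repr (w j))) else 0)); last first.
  move=> p _; rewrite !ffunE; apply: eq_bigr => i _; apply: eq_bigr => j _.
  rewrite !ffunE; case: ifP => _ /=; last by rewrite linear0l linear0.
  by case: ifP => _ //=; rewrite linear0r linear0.
rewrite exchange_big /=; case: ifP => [/eqP mk|/eqP mk].
  apply: eq_bigr => i _; rewrite exchange_big /=; apply: eq_bigr => j /eqP ij.
  have ik : (i.+1 < k.+1)%N by lia.
  rewrite (bigD1 (Ordinal ik)) //= eqxx.
  have -> : (j.+1 == k - i.+1)%N by lia.
  rewrite big1 ?addr0 // => p /eqP pr; case: ifP => // /andP[/eqP ip _].
  by case: pr; apply: val_inj.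
rewrite big1 // => i _; rewrite exchange_big big1 // => j /eqP ij.
by rewrite big1 // => p _; case: ifP => // /andP[/eqP ip /eqP jp]; lia.
Qed.

(** Degree [k.+2] of [gr] is spanned by classes of brackets [br a b] with [a] in the
    [k.+1]-st term of the lower central series.  The spanning family has no bound on
    its size, hence the list of pairs. *)
Lemma degree_comp_generated k (u : gr br s) : exists ab : seq (gr br s * gr br s),
  degree_comp k.+2 u =
  \sum_(p <- ab) gr_bracket (degree_comp k.+1 p.1) (degree_comp 1 p.2).
Proof.
have [ks|ks] := boolP (k.+1 < s.-1)%N; last first.
  exists [::]; rewrite big_nil; apply/ffunP => i; rewrite !ffunE.
  by case: eqP => // ik; have := ltn_ord i; lia.
pose i0 : 'I_s.-1 := Ordinal ks.
have mem : quot_repr (u i0) \in brv br (lcs br k.+1) fullv by apply: quot_repr_mem.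
pose B := in_tuple [seq br a b | a <- vbasis (lcs br k.+1), b <- vbasis fullv].
have E := coord_span (X := B) mem.
pose cl m (a : V) : gr br s := [ffun i : 'I_s.-1 =>
  quot_map (lcs br i.+1) (lcs br i.+2) (if i.+1 == m then a else 0)].
have clE m a : degree_comp m (cl m a) = cl m a.
  by apply/ffunP => i; rewrite !ffunE; case: (i.+1 == m); rewrite ?linear0.
(* An arbitrary list and arbitrary coefficients, so that induction on the list applies. *)
suff H (t : seq V) (c : nat -> F) : {subset t <= B} -> exists ab : seq (gr br s * gr br s),
    [ffun i : 'I_s.-1 => quot_map (lcs br i.+1) (lcs br i.+2)
      (if i.+1 == k.+2 then \sum_(m < size t) c m *: t`_m else 0)] =
    \sum_(p <- ab) gr_bracket (degree_comp k.+1 p.1) (degree_comp 1 p.2).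
  have [ab abE] := H B (fun m => if insub m is Some m' then coord B m' (quot_repr (u i0)) else 0)
     (fun x h => h).
  exists ab; rewrite -abE; apply/ffunP => i; rewrite !ffunE.
  case: eqP => ik; last by rewrite linear0.
  have <- : i0 = i by apply: val_inj => /=; lia.
  rewrite -[LHS]quot_mapK; congr (quot_map _ _ _); rewrite {1}E.
  by apply: eq_bigr => m _; rewrite valK.
elim: t c => [|w t IH] c tB.
  exists [::]; rewrite big_nil; apply/ffunP => i; rewrite !ffunE big_ord0.
  by case: ifP => _; rewrite linear0.
have [|ab abE] := IH (fun m => c m.+1); first by move=> x xt; apply: tB; rewrite inE xt orbT.
have /allpairsP[[a b] /= [aB _ wE]] : w \in B by apply: tB; rewrite mem_head.
exists ((cl k.+1 (c 0%N *: a), cl 1%N b) :: ab); rewrite big_cons /= -abE !clE.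
rewrite gr_bracketE //; first last.
- by move=> i; case: eqP => [->|_]; rewrite ?mem0v ?memvf.
- move=> i; case: eqP => [->|_]; rewrite ?mem0v // memvZ //.
  exact: vbasis_mem.
apply/ffunP => m; rewrite dsum_addE !ffunE big_ord_recl /=.
have -> : \sum_(i < size t) c (bump 0 i) *: t`_i = \sum_(i < size t) c i.+1 *: t`_i by [].
case: eqP => mk; last first.
  rewrite linear0 addr0 big1 // => i _; rewrite big1 // => j /eqP ij.
  case: eqP => ik; last by rewrite linear0l linear0.
  by case: eqP => jk; [lia | rewrite linear0r linear0].
rewrite linearD /=; congr (_ + _).
have k0 : (k < s.-1)%N by lia.
have s0 : (0 < s.-1)%N by lia.
rewrite (bigD1 (Ordinal k0)) //= eqxx (bigD1 (Ordinal s0)) /=; last by rewrite mk; lia.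
rewrite linearZl_LR /= wE [X in _ + X + _]big1 ?addr0; last first.
  move=> j /andP[_ /eqP jn]; case: eqP => j1; last by rewrite linear0r linear0.
  by case: jn; apply: val_inj => /=; lia.
rewrite big1 ?addr0 // => i /eqP ik; rewrite big1 // => j _.
case: eqP => i1; last by rewrite linear0l linear0.
by case: ik; apply: val_inj => /=; lia.
Qed.

Lemma graded_from_gr : graded_by s (fun k => linfun (degree_part k)).
Proof.
have hL : forall (a : F) u w, h (a *: u + w) = a *: h u + h w.
  by move=> a u w; apply: (can_inj gK); rewrite linearP !hK.
have h0 : h 0 = 0 by apply: (can_inj gK); rewrite hK linear0.
have hsum (I : Type) (r : seq I) (E : I -> gr br s) : h (\sum_(i <- r) E i) = \sum_(i <- r) h (E i).
  elim: r => [|i r IH]; rewrite ?big_nil ?big_cons //.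
  by rewrite -IH -{1}[E i]scale1r hL scale1r.
have hM u w : h (gr_bracket u w) = br (h u) (h w).
  by apply: (can_inj gK); rewrite gM !hK.
split.
- move=> z; apply: (can_inj gK); rewrite linear_sum /=.
  apply/ffunP => i; rewrite dsum_sumE.
  have is_ : (i.+1 < s)%N by have := ltn_ord i; lia.
  rewrite (bigD1 (Ordinal is_)) //= lfunE /= hK ffunE eqxx.
  rewrite big1 ?addr0 // => j /eqP ji; rewrite lfunE /= hK ffunE.
  by case: eqP => // ij; case: ji; apply: val_inj.
- move=> k l z; rewrite !lfunE /= /degree_part hK; case: eqP => kl.
    congr h; apply/ffunP => i; rewrite !ffunE kl.
    by case: (i.+1 == l).
  rewrite -[RHS]h0; congr h; apply/ffunP => i; rewrite !ffunE.
  by case: eqP => // ik; case: eqP => // il; case: kl; rewrite -ik -il.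
- by move=> z; rewrite lfunE /= -[RHS]h0; congr h; apply/ffunP => i; rewrite !ffunE.
- move=> k a b; rewrite lfunE /= {1}/degree_part gM degree_comp_bracket hsum.
  by apply: eq_bigr => i _; rewrite !lfunE hM.
- move=> k z; rewrite lfunE /= {1}/degree_part.
  have [ab ->] := degree_comp_generated k (g z).
  rewrite hsum; apply: memv_suml => p _; rewrite hM.
  have P m u : h (degree_comp m u) \in limg (linfun (degree_part m)).
    apply/memv_imgP; exists (h u); first exact: memvf.
    by rewrite lfunE /= /degree_part hK.
  by apply: memv_brv; apply: P.
Qed.
End FromGr.

Lemma naturally_graded_grading : leibniz br -> naturally_graded br ->
  exists s pr, graded_by s pr.
Proof.
move=> leib [s [_ [g [[h gK hK] gM]]]].
by exists s; eexists; apply: (graded_from_gr leib gK hK gM).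
Qed.
End Grading.

(** * Pieces and tails of a grading *)

HB.instance Definition _ (F : fieldType) (V : vectType F)
    (br : {bilinear V -> V -> V}) (x : V) :=
  GRing.isLinear.Build F V V _ (rmul br x) (fun a u w => linearPl br x a u w).

Definition brE := (linearDl, linearDr, linearBl, linearBr, linearNl, linearNr,
  linearZl_LR, linearZr_LR, linear0l, linear0r).

Section GradedFacts.
Context {F : fieldType} {V : vectType F} {br : {bilinear V -> V -> V}}.
Context {s : nat} {pr : nat -> 'End(V)} (grd : graded_by br s pr).
Local Notation "a ** b" := (br a b) (at level 40, left associativity).
Local Notation A k := (limg (pr k)).

(** The sum of the pieces of degree at least [k], written as an intersection of kernels so
    that membership is a condition on components. *)
Definition tail k : {vspace V} := (\bigcap_(i < k) lker (pr i))%VS.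

Lemma prK k z : z \in A k -> pr k z = z.
Proof. by case: grd => _ h _ _ _ /memv_imgP[w _ ->]; rewrite h eqxx. Qed.

Lemma pr_piece j k z : z \in A k -> pr j z = if j == k then z else 0.
Proof.
case: grd => _ h _ _ _ /memv_imgP[w _ ->]; rewrite h.
by case: eqP => // ->.
Qed.

Lemma pr_mem k z : pr k z \in A k.
Proof. exact/memv_img/memvf. Qed.

Lemma pr0 z : pr 0%N z = 0.
Proof. by case: grd. Qed.

Lemma pr_bracket k a b : pr k (a ** b) = \sum_(i < k.+1) pr i a ** pr (k - i)%N b.
Proof. by case: grd. Qed.

Lemma piece_mul i j a b : a \in A i -> b \in A j -> a ** b \in A (i + j)%N.
Proof.
move=> ai bj; suff <- : pr (i + j)%N (a ** b) = a ** b by apply: pr_mem.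
have ilt : (i < (i + j).+1)%N by lia.
rewrite pr_bracket (bigD1 (Ordinal ilt)) //= addKn !prK // big1 ?addr0 // => m /eqP mi.
rewrite (pr_piece _ ai); case: eqP => [mE|]; last by rewrite linear0l.
by case: mi; apply: val_inj.
Qed.

Lemma tailP k z : reflect (forall i, (i < k)%N -> pr i z = 0) (z \in tail k).
Proof.
apply: (iffP idP) => [zk i ik|h].
  apply/eqP; rewrite -memv_ker; apply: subvP zk.
  exact: (@bigcapv_inf _ _ _ (Ordinal ik)).
rewrite memvE; apply/subv_bigcapP => i _; rewrite -memvE memv_ker; apply/eqP.
exact: h.
Qed.

Lemma tail1 : tail 1 = fullv.
Proof. by apply/vspaceP => z; rewrite memvf; apply/tailP => -[|//] _; apply: pr0. Qed.

Lemma piece_tail k z : z \in A k -> z \in tail k.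
Proof.
by move=> zk; apply/tailP => i ik; rewrite (pr_piece _ zk); case: eqP => //; lia.
Qed.

Lemma dim_tail k : \dim (tail k) = (\dim (A k) + \dim (tail k.+1))%N.
Proof.
rewrite -(limg_ker_dim (pr k) (tail k)) addnC; congr (_ + _)%N; last first.
  by rewrite /tail big_ord_recr.
congr (\dim _); apply/vspaceP => z; apply/idP/idP => [|zk].
  by case/memv_imgP => w _ ->; apply: pr_mem.
by rewrite -(prK zk); apply/memv_img/piece_tail.
Qed.

Lemma dim_split m :
  \dim {:V} = (\sum_(1 <= k < m.+1) \dim (A k) + \dim (tail m.+1))%N.
Proof.
elim: m => [|m IH]; first by rewrite big_nil tail1.
by rewrite big_nat_recr //= IH dim_tail addnA.
Qed.

Lemma tail_mul i j a b : a \in tail i -> b \in tail j ->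
  a ** b \in tail (i + j)%N /\ pr (i + j)%N (a ** b) = pr i a ** pr j b.
Proof.
move=> /tailP ai /tailP bj; split.
  apply/tailP => k kij; rewrite pr_bracket big1 // => m _.
  have [mi|mi] := ltnP m i; first by rewrite ai // linear0l.
  by rewrite (bj (k - m)%N) ?linear0r //; have := ltn_ord m; lia.
have ilt : (i < (i + j).+1)%N by lia.
rewrite pr_bracket (bigD1 (Ordinal ilt)) //= addKn big1 ?addr0 // => m /eqP mi.
have [lt_mi|] := ltnP m i; first by rewrite ai // linear0l.
rewrite leq_eqVlt => /predU1P[im|im]; first by case: mi; apply: val_inj.
by rewrite (bj (i + j - m)%N) ?linear0r //; have := ltn_ord m; lia.
Qed.

Lemma pr2 a b : pr 2%N (a ** b) = pr 1%N a ** pr 1%N b.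
Proof.
by rewrite pr_bracket !big_ord_recl big_ord0 /= !pr0 !brE !addr0 add0r.
Qed.

Lemma pr3 a b : pr 3%N (a ** b) = pr 1%N a ** pr 2%N b + pr 2%N a ** pr 1%N b.
Proof.
by rewrite pr_bracket !big_ord_recl big_ord0 /= !pr0 !brE !addr0 add0r.
Qed.

Lemma pr4 a b : pr 4%N (a ** b) =
  pr 1%N a ** pr 3%N b + pr 2%N a ** pr 2%N b + pr 3%N a ** pr 1%N b.
Proof.
by rewrite pr_bracket !big_ord_recl big_ord0 /= !pr0 !brE !addr0 add0r addrA.
Qed.

Lemma pr_sum z : z = \sum_(k < s) pr k z.
Proof. by case: grd => h _ _ _ _; apply: h. Qed.

Lemma pieceS k : (A k.+2 <= brv br (A k.+1) (A 1%N))%VS.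
Proof. by apply/subvP => z /prK <-; case: grd. Qed.

Lemma tail2_lcs : (tail 2 <= lcs br 2)%VS.
Proof.
apply/subvP => z /tailP z2; rewrite (pr_sum z); apply: memv_suml => -[k ks] _ /=.
case: k ks => [|[|k]] ks; try by rewrite z2 ?mem0v.
have /(subvP (pieceS k)) : pr k.+2 z \in A k.+2 by apply: pr_mem.
apply: subvP.
by apply: brv_sub => a b _ _; apply: memv_brv; apply: memvf.
Qed.

(** Degree one generates, so a vanishing piece ends the grading. *)
Lemma piece_eq0S k : (0 < k)%N -> A k = 0%VS -> A k.+1 = 0%VS.
Proof.
case: k => // k _ k0; apply/eqP; rewrite -subv0; apply: subv_trans (pieceS k) _.
by apply: brv_sub => a b; rewrite k0 memv0 => /eqP -> _; rewrite linear0l mem0v.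
Qed.

Lemma piece_eq0 k m : (0 < k <= m)%N -> A k = 0%VS -> A m = 0%VS.
Proof.
case/andP => k0; elim: m => [|m IH]; first by case: k k0.
rewrite leq_eqVlt => /predU1P[-> //|km /(IH km)]; apply: piece_eq0S; lia.
Qed.

Lemma tail_eq0 k : (0 < k)%N -> A k = 0%VS -> tail k = 0%VS.
Proof.
move=> k0 Ak; apply/eqP; rewrite -subv0; apply/subvP => z /tailP zk.
rewrite (pr_sum z) memv0 big1 // => i _; have [ik|ik] := ltnP i k; first exact: zk.
have : pr i z \in A i by apply: pr_mem.
by rewrite (@piece_eq0 k i) ?k0 // memv0 => /eqP.
Qed.

Lemma piece_neq0 m k z : z \in tail m -> z != 0 -> (0 < k <= m)%N ->
  (0 < \dim (A k))%N.
Proof.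
move=> zm z0 km; rewrite lt0n; apply: contra z0.
rewrite dimv_eq0 => /eqP /(piece_eq0 km) /tail_eq0 tm; rewrite -memv0 -tm //.
by case/andP: km; apply: leq_trans.
Qed.

(** All pieces up to [m] are nonzero, so each contributes at least one to the total
    dimension; the sum counts what selected pieces contribute beyond that. *)
Lemma dim_excess m z (r : seq nat) : z \in tail m -> z != 0 ->
  uniq r -> {subset r <= index_iota 1 m.+1} ->
  (\sum_(k <- r) (\dim (A k)).-1 + m + \dim (tail m.+1) <= \dim {:V})%N.
Proof.
move=> zm z0 r_uniq r_sub; rewrite (dim_split m) leq_add2r.
have -> : (\sum_(1 <= k < m.+1) \dim (A k) =
           \sum_(1 <= k < m.+1) ((\dim (A k)).-1 + 1))%N.
  apply: eq_big_nat => k km.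
  by have := @piece_neq0 m k z zm z0; lia.
rewrite big_split /= sum_nat_const_nat muln1 subn1 leq_add2r.
apply: (uniq_sub_le_big leqnn (fun a b => leq_addr b a)) => //; exact: iota_uniq.
Qed.

Lemma tail_next k z : z \in tail k -> z - pr k z \in tail k.+1.
Proof.
move/tailP => zk; apply/tailP => i; rewrite ltnS leq_eqVlt linearB /=.
rewrite (pr_piece i (pr_mem k z)); case: eqP => [->|_] /= ik; first by rewrite subrr.
by rewrite zk // subr0.
Qed.

Section Generators.
Context {x y : V} (A1 : (A 1%N <= <[x]> + <[y]>)%VS).

Lemma piece_next k z : z \in A k.+2 ->
  exists a b, [/\ a \in A k.+1, b \in A k.+1 & z = a ** x + b ** y].
Proof.
move=> zk; suff : z \in (linfun (rmul br x) @: A k.+1 + linfun (rmul br y) @: A k.+1)%VS.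
  case/memv_addP => _ /memv_imgP[a ak ->] [_ /memv_imgP[b bk ->]] ->.
  by exists a, b; rewrite !lfunE.
apply: subvP zk; apply: subv_trans (pieceS k) _; apply: brv_sub => a w ak /(subvP A1).
case/memv_addP => _ /vlineP[c ->] [_ /vlineP[d ->] ->].
rewrite linearDr !linearZr_LR /= memv_add // memvZ //.
  by have := memv_img (linfun (rmul br x)) ak; rewrite lfunE.
by have := memv_img (linfun (rmul br y)) ak; rewrite lfunE.
Qed.

Lemma piece_next_line k w (U : {vspace V}) : (A k.+1 <= <[w]>)%VS ->
  w ** x \in U -> w ** y \in U -> (A k.+2 <= U)%VS.
Proof.
move=> kw xU yU; apply/subvP => z /piece_next[a [b [/(subvP kw)/vlineP[c ->] + ->]]].
by move/(subvP kw)/vlineP => [d ->]; rewrite !linearZl_LR memvD ?memvZ.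
Qed.
End Generators.
End GradedFacts.

(** * Two chains spanning the algebra *)

Section LineFacts.
Context {F : fieldType} {V : vectType F}.

Lemma memv_plane (z a b : V) : z \in (<[a]> + <[b]>)%VS -> exists c d, z = c *: a + d *: b.
Proof. by case/memv_addP => _ /vlineP[c ->] [_ /vlineP[d ->] ->]; exists c, d. Qed.

Lemma plane_mem (a b : V) c d : c *: a + d *: b \in (<[a]> + <[b]>)%VS.
Proof. by rewrite memv_add // memvZ // memv_line. Qed.

Lemma dim_plane_le (a b : V) : (\dim (<[a]> + <[b]>) <= 2)%N.
Proof.
by apply: leq_trans (dimv_add_leqif _ _) _; rewrite !dim_vline; do 2!case: (_ != 0).
Qed.

Lemma dim_line_le (U : {vspace V}) (a : V) : (U <= <[a]>)%VS -> (\dim U <= 1)%N.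
Proof. by move/dimvS => h; apply: leq_trans h _; rewrite dim_vline; case: (_ != 0). Qed.

Lemma dim_le1_line (U : {vspace V}) (a : V) : a \in U -> a != 0 -> (\dim U <= 1)%N ->
  (U <= <[a]>)%VS.
Proof.
move=> aU a0 dU; suff /eqP <- : (<[a]>%VS == U) by [].
by rewrite eqEdim -memvE aU dim_vline a0.
Qed.

Lemma dim_plane (a b : V) : a != 0 -> b \notin <[a]>%VS -> \dim (<[a]> + <[b]>) = 2.
Proof.
move=> a0 ba; apply/eqP; rewrite eqn_leq dim_plane_le /= ltnNge.
apply: contra ba => d1; apply: (subvP (dim_le1_line _ a0 d1)).
  by apply: (subvP (addvSl _ _)); apply: memv_line.
by apply: (subvP (addvSr _ _)); apply: memv_line.
Qed.
End LineFacts.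

Lemma natmul_eq0 {F : numFieldType} {V : vectType F} (z : V) k :
  (z *+ k.+1 == 0) = (z == 0).
Proof. by rewrite -scaler_nat scaler_eq0 Num.Theory.pnatr_eq0. Qed.

Section RightPowers.
Context {F : fieldType} {V : vectType F} {br : {bilinear V -> V -> V}}.
Context (leib : leibniz br).
Local Notation "a ** b" := (br a b) (at level 40, left associativity).

Definition rpow (x z : V) (k : nat) : V := iter k (rmul br x) z.

Lemma rpowS x z k : rpow x z k.+1 = rpow x z k ** x.
Proof. by []. Qed.

Lemma rpowSr x z k : rpow x z k.+1 = rpow x (z ** x) k.
Proof. by rewrite /rpow iterSr. Qed.

Lemma rpow0 x k : rpow x 0 k = 0.
Proof. by elim: k => // k IH; rewrite rpowS IH linear0l. Qed.

Lemma rpowD x k j z : rpow x z (k + j) = rpow x (rpow x z k) j.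
Proof. by rewrite /rpow addnC iterD. Qed.

Lemma rpow_eq0 x z j k : (j <= k)%N -> rpow x z j = 0 -> rpow x z k = 0.
Proof. by move=> jk z0; rewrite -(subnKC jk) rpowD z0 rpow0. Qed.

Lemma rpowL x k c d a b :
  rpow x (c *: a + d *: b) k = c *: rpow x a k + d *: rpow x b k.
Proof. by elim: k => // k IH; rewrite !rpowS IH !brE. Qed.

Lemma leibD z a b : z ** (a ** b) = z ** a ** b - z ** b ** a.
Proof. exact: leib. Qed.

Definition rann (a : V) : Prop := forall z, z ** a = 0.

Lemma rann_sqr a : rann (a ** a).
Proof. by move=> z; rewrite leibD subrr. Qed.

Lemma rann_sym a b : rann (a ** b + b ** a).
Proof. by move=> z; rewrite linearDr !leibD addrA subrK subrr. Qed.

Lemma rann_mul a b : rann a -> rann (a ** b).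
Proof. by move=> ra z; rewrite leibD !ra linear0l subrr. Qed.

Lemma rannZ c a : rann a -> rann (c *: a).
Proof. by move=> ra z; rewrite !brE ra scaler0. Qed.

Lemma rann_comm a b z : rann (a ** b) -> z ** a ** b = z ** b ** a.
Proof. by move/(_ z); rewrite leibD => /eqP; rewrite subr_eq0 => /eqP. Qed.
End RightPowers.
Arguments rpow {F V} br x z k.
Arguments rann {F V} br a.

(** The intended basis: the powers of [x] fill the indices up to [n - 3], and [y],
    [y x], [y x x] the last three. *)
Definition chain {F : fieldType} {V : vectType F} (n : nat)
    (br : {bilinear V -> V -> V}) (x y : V) (i : nat) : V :=
  if (i <= n - 3)%N then rpow br x x i.-1 else rpow br x y (i - (n - 2)).

(** What remains of the grading once the two chains are known to form a basis: each
    product by [y] lies in the piece of the expected degree. *)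
Record graded_chains {F : fieldType} {V : vectType F} (n : nat)
    (br : {bilinear V -> V -> V}) (x y : V) : Prop := GradedChains {
  gc_basis : basis_of fullv [seq chain n br x y i | i <- iota 1 n];
  gc_xtop : rpow br x x (n - 3) = 0;
  gc_ytop : br (br (br y x) x) x = 0;
  gc_xy : br x y \in (<[br x x]> + <[br y x]>)%VS;
  gc_yy : br y y \in (<[br x x]> + <[br y x]>)%VS;
  gc_x2y : br (br x x) y \in (<[br (br x x) x]> + <[br (br y x) x]>)%VS;
  gc_uy : br (br y x) y \in (<[br (br x x) x]> + <[br (br y x) x]>)%VS;
  gc_xky : forall k, (2 <= k)%N -> br (rpow br x x k) y \in <[rpow br x x k.+1]>%VS;
  gc_vy : br (br (br y x) x) y \in <[rpow br x x 3]>%VS }.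

Section Structure.
Context {F : numFieldType} {V : vectType F} {br : {bilinear V -> V -> V}}.
Local Notation "a ** b" := (br a b) (at level 40, left associativity).
Local Notation "x ^: k" := (rpow br x x k) (at level 30).
Context {n s : nat} {pr : nat -> 'End(V)} {e : nat -> V}.
Hypotheses (n9 : (9 <= n)%N) (dimV : \dim {:V} = n).
Hypotheses (leib : leibniz br) (grd : graded_by br s pr).
Hypothesis e_basis : basis_of fullv [seq e i | i <- iota 1 n].
Hypothesis e1_gen : e 1%N \notin lcs br 2.
Hypothesis eS : forall i, (1 <= i <= n - 1)%N -> i <> (n - 3)%N -> e i ** e 1%N = e i.+1.
Hypothesis e_end1 : e (n - 3)%N ** e 1%N = 0.
Hypothesis e_end2 : e n ** e 1%N = 0.

Local Notation A k := (limg (pr k)).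
Local Notation tail k := (tail (pr := pr) k).

Let x := pr 1%N (e 1%N).
Let y := pr 1%N (e (n - 2)%N).
Let rho := linfun (rmul br (e 1%N)).

Lemma rhoE z : rho z = z ** e 1%N.
Proof. by rewrite lfunE. Qed.

Lemma x_piece : x \in A 1%N. Proof. exact: pr_mem. Qed.
Lemma y_piece : y \in A 1%N. Proof. exact: pr_mem. Qed.

Lemma in_tail1 z : z \in tail 1.
Proof. by rewrite (tail1 grd) memvf. Qed.

Lemma fullv_rho : (fullv <= limg rho + (<[e 1%N]> + <[e (n - 2)%N]>))%VS.
Proof.
rewrite -{1}(span_basis e_basis); apply/span_subvP => _ /mapP[i + ->].
rewrite mem_iota => i1; have [->|i_1] := eqVneq i 1%N.
  by apply: subv_trans (addvSr _ _); rewrite -memvE; apply: (subvP (addvSl _ _)); apply: memv_line.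
have [->|i_n] := eqVneq i (n - 2)%N.
  by apply: subv_trans (addvSr _ _); rewrite -memvE; apply: (subvP (addvSr _ _)); apply: memv_line.
have -> : e i = rho (e i.-1).
  rewrite rhoE eS; [congr e | | ]; lia.
by apply: (subvP (addvSl _ _)); rewrite memv_img ?memvf.
Qed.

Lemma rho_tail k z : z \in tail k -> rho z \in tail k.+1 /\ pr k.+1 (rho z) = pr k z ** x.
Proof.
by move=> zk; rewrite rhoE; have := tail_mul grd zk (in_tail1 (e 1%N)); rewrite addn1.
Qed.

Lemma piece1 : (A 1%N <= <[x]> + <[y]>)%VS.
Proof.
apply/subvP => _ /memv_imgP[z _ ->].
have := subvP fullv_rho _ (memvf z); case/memv_addP => _ /memv_imgP[w _ ->] [t].
move=> /memv_plane[c [d ->]] ->; rewrite !linearD !linearZ /=.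
have /rho_tail[/tailP -> // _] := in_tail1 w.
by rewrite add0r plane_mem.
Qed.

(** [R_(e_1)] has rank at least [n - 2], hence a kernel of dimension at most 2. *)
Lemma dim_rho U : (\dim U <= \dim (rho @: U) + 2)%N.
Proof.
have := dimvS fullv_rho; have := dimv_add_leqif (limg rho) (<[e 1%N]> + <[e (n - 2)%N]>).
case=> + _; have := dim_plane_le (e 1%N) (e (n - 2)%N).
have := limg_ker_dim rho fullv; have := limg_ker_dim rho U.
have := dimvS (capvSr U (lker rho)); rewrite capfv; lia.
Qed.

(** [R_(e_1)] maps [tail k] into [tail k.+1] and loses at most two dimensions: if the
    piece of degree [k] accounts for two, the map is onto, and its leading part is
    multiplication by [x]. *)
Lemma piece_rho k : (0 < k)%N -> (\dim (tail k.+1) + 2 <= \dim (tail k))%N ->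
  (A k.+1 <= linfun (rmul br x) @: A k)%VS.
Proof.
move=> k0 dk; have sub : (rho @: tail k <= tail k.+1)%VS.
  by apply/subvP => _ /memv_imgP[z zk ->]; case: (rho_tail zk).
have /eqP E : (rho @: tail k == tail k.+1)%VS.
  by rewrite eqEdim sub /=; have := dim_rho (tail k); lia.
apply/subvP => z zk; rewrite -(prK grd zk).
have : z \in tail k.+1 by apply: (piece_tail grd).
rewrite -E => /memv_imgP[w wk ->]; have [_ ->] := rho_tail wk.
by have := memv_img (linfun (rmul br x)) (pr_mem (pr := pr) k w); rewrite lfunE.
Qed.

Lemma e_tail i j m : (0 < i)%N -> (i + j <= n - 3)%N -> e i \in tail m ->
  e (i + j)%N \in tail (m + j).
Proof.
move=> i0 + im; elim: j => [|j IH] ij; first by rewrite !addn0.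
have /rho_tail[+ _] : e (i + j)%N \in tail (m + j) by apply: IH; lia.
by rewrite rhoE eS ?addnS //; lia.
Qed.

Lemma e_top_neq0 : e (n - 3)%N != 0.
Proof.
apply: contraTneq (basis_free e_basis) => e0; apply/negP => /free_not0 h.
have : 0 \in [seq e i | i <- iota 1 n].
  by rewrite -e0 map_f // mem_iota; lia.
by move/h; rewrite eqxx.
Qed.

Lemma pr_e k : (k.+1 <= n - 3)%N -> e k.+1 \in tail k.+1 /\ pr k.+1 (e k.+1) = x ^: k.
Proof.
elim: k => [|k IH] kn; first by rewrite in_tail1.
have [|ek prE] := IH; first by lia.
by have := rho_tail ek; rewrite rhoE eS ?prE //; lia.
Qed.

(** Leading part of [e_(n-3) e_1 = 0]. *)
Lemma xpow_top : x ^: (n - 3) = 0.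
Proof.
have [|en prE] := @pr_e (n - 4); first by lia.
have [_] := rho_tail en; have -> : (n - 4).+1 = (n - 3)%N by lia.
rewrite rhoE e_end1 linear0 => /esym; have -> : (n - 3)%N = (n - 4).+1 by lia.
by rewrite prE.
Qed.

(** Leading part of [e_n e_1 = 0]. *)
Lemma ypow3 : y ** x ** x ** x = 0.
Proof.
have e1 : e (n - 2)%N ** e 1%N = e (n - 1)%N.
  by rewrite eS; [congr e|..]; lia.
have e2 : e (n - 1)%N ** e 1%N = e n.
  by rewrite eS; [congr e|..]; lia.
have [t1] := rho_tail (in_tail1 (e (n - 2)%N)); rewrite !rhoE e1 => p1.
have := rho_tail t1; rewrite !rhoE e1 e2 p1 => -[t2 p2].
by have := rho_tail t2; rewrite !rhoE e_end2 linear0 p2 => -[_ <-].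
Qed.

Lemma x_neq0 : x != 0.
Proof.
apply: contraNneq e1_gen => x0; apply: (subvP (tail2_lcs grd)).
by apply/tailP => -[|[|//]] _; rewrite ?(pr0 grd).
Qed.

Lemma dim_upper m : A m.+1 = 0%VS ->
  \dim {:V} = (\sum_(1 <= k < m.+1) \dim (A k))%N.
Proof.
by move=> m0; rewrite (dim_split grd m) (tail_eq0 grd) // dimv0 addn0.
Qed.

(** If [x] alone spanned degree one, the algebra would be spanned by the powers of
    [x], of which only [n - 3] are nonzero. *)
Lemma dim_piece1 : \dim (A 1%N) = 2.
Proof.
apply/eqP; rewrite eqn_leq (leq_trans (dimvS piece1)) ?dim_plane_le //= ltnNge.
apply/negP => d1; have A1x := dim_le1_line x_piece x_neq0 d1.
have {}A1x : (A 1%N <= <[x]> + <[x]>)%VS by rewrite addvv.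
have Ak k : (A k.+1 <= <[x ^: k]>)%VS.
  elim: k => [|k IH]; first by rewrite /= -[X in (_ <= X)%VS]addvv.
  by apply: (piece_next_line grd A1x IH); rewrite -rpowS memv_line.
have A0 : A (n - 3).+1 = 0%VS.
  by apply/eqP; rewrite -subv0; apply: subv_trans (Ak _) _; rewrite xpow_top -memvE mem0v.
have := dim_upper A0; rewrite dimV.
have : (\sum_(1 <= k < (n - 3).+1) \dim (A k) <= \sum_(1 <= k < (n - 3).+1) 1)%N.
  rewrite big_nat_cond [X in (_ <= X)%N]big_nat_cond; apply: leq_sum => -[|k]; first by lia.
  by move=> _; apply: dim_line_le (Ak k).
rewrite sum_nat_const_nat; lia.
Qed.

Lemma dim_tail2 : \dim (tail 2) = (n - 2)%N.
Proof. by have := dim_tail grd 1; rewrite (tail1 grd) dimV dim_piece1; lia. Qed.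

Lemma limg_rmul_plane (U : {vspace V}) a b z : (U <= <[a]> + <[b]>)%VS ->
  (linfun (rmul br z) @: U <= <[a ** z]> + <[b ** z]>)%VS.
Proof.
move=> Uab; apply/subvP => _ /memv_imgP[w /(subvP Uab)/memv_plane[c [d ->]] ->].
by rewrite lfunE /= /rmul !brE plane_mem.
Qed.

Lemma piece2 : (A 2%N <= <[x ** x]> + <[y ** x]>)%VS.
Proof.
apply: subv_trans (limg_rmul_plane _ piece1); apply: piece_rho => //.
by rewrite (tail1 grd) dim_tail2 dimV; lia.
Qed.

Definition two_chains : Prop :=
  (A 3%N <= <[x ** x ** x]> + <[y ** x ** x]>)%VS /\
  forall k, (3 <= k)%N -> (A k.+1 <= <[x ^: k]>)%VS.

(** [R_x] and [R_y] commute here, and [A_1 y] is contained in [A_2 = A_1 x]; pushing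
    [y] to the left of the [x] factors gives [A_(k+1) = A_k x]. *)
Lemma two_chains_comm : rann br (y ** x) -> two_chains.
Proof.
move=> ru; have Ak k : (A k.+1 <= <[x ^: k]> + <[rpow br x y k]>)%VS.
  elim: k => [|k IH]; first exact: piece1.
  have comm w : rpow br x w k ** y = rpow br x (w ** y) k.
    by elim: (k) => // j jH; rewrite !rpowS -jH (rann_comm leib _ ru).
  have plane w : w \in A 2%N -> rpow br x w k \in (<[x ^: k.+1]> + <[rpow br x y k.+1]>)%VS.
    by move/(subvP piece2)/memv_plane => [c [d ->]]; rewrite rpowL -!rpowSr plane_mem.
  apply/subvP => z /(piece_next grd piece1)[a [b [/(subvP IH) aP /(subvP IH) bP ->]]].
  case/memv_plane: aP => [c1 [c2 ->]]; case/memv_plane: bP => [d1 [d2 ->]].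
  rewrite memvD //; first by rewrite !brE -!rpowS plane_mem.
  rewrite !brE !comm memvD // memvZ // plane //.
    exact: (piece_mul grd x_piece y_piece).
  exact: (piece_mul grd y_piece y_piece).
split=> [|k k3]; first exact: Ak 2.
apply: subv_trans (Ak k) _; by rewrite (rpow_eq0 k3 ypow3) addv0.
Qed.

Lemma xpow_piece k : x ^: k \in A k.+1.
Proof.
elim: k => [|k IH]; first exact: x_piece.
by rewrite rpowS -addn1; apply: (piece_mul grd IH x_piece).
Qed.

Section NonCommuting.
Context {z0 : V} (z0u : z0 ** (y ** x) != 0).
Let u := y ** x.

Lemma u_piece : u \in A 2%N.
Proof. exact: (piece_mul grd y_piece x_piece). Qed.

(** The degree two part of the annihilator is at most a line, since [u] is not in it. *)
Lemma rann_piece2 a : a \in A 2%N -> rann br a -> exists c, a = c *: (x ** x).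
Proof.
move=> /(subvP piece2)/memv_plane[c [d ->]] /(_ z0) /eqP.
rewrite !brE (rann_sqr leib) scaler0 add0r scaler_eq0 (negPf z0u) orbF => /eqP ->.
by exists c; rewrite scale0r addr0.
Qed.

Lemma xy_eq : exists c, x ** y = c *: (x ** x) - u.
Proof.
have [|c cE] := rann_piece2 _ (rann_sym leib x y).
  by rewrite memvD ?(piece_mul grd x_piece y_piece) ?u_piece.
by exists c; rewrite -cE addrK.
Qed.

Lemma yy_eq : exists c, y ** y = c *: (x ** x).
Proof.
by apply: rann_piece2 (rann_sqr leib y); apply: (piece_mul grd y_piece y_piece).
Qed.

Lemma e2_eq : e 2%N = e 1%N ** e 1%N.
Proof. by rewrite eS //; lia. Qed.

Lemma e2_parts : pr 2%N (e 2%N) = x ** x /\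
  pr 3%N (e 2%N) = x ** pr 2%N (e 1%N) + pr 2%N (e 1%N) ** x.
Proof. by rewrite e2_eq (pr2 grd) (pr3 grd). Qed.

Lemma e2_tail : e 2%N \in tail 2.
Proof. by rewrite e2_eq -rhoE; case: (rho_tail (in_tail1 (e 1%N))). Qed.

Lemma top_tail i m : (0 < i <= n - 3)%N -> e i \in tail m ->
  e (n - 3)%N \in tail (m + (n - 3 - i)).
Proof. by move=> iN /(@e_tail i (n - 3 - i)); rewrite subnKC; [apply|]; lia. Qed.

Lemma dim_piece_excess m (r : seq nat) : e (n - 3)%N \in tail m ->
  uniq r -> {subset r <= index_iota 1 m.+1} ->
  (\sum_(k <- r) (\dim (A k)).-1 + m + \dim (tail m.+1) <= n)%N.
Proof. by move=> em ur rm; rewrite -dimV; apply: (dim_excess grd em e_top_neq0). Qed.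

Lemma dim_piece_gt0 k : (0 < k <= n - 3)%N -> (0 < \dim (A k))%N.
Proof.
have [|+ _] := @pr_e (n - 4); first by lia.
have -> : (n - 4).+1 = (n - 3)%N by lia.
by move=> en /(piece_neq0 grd en e_top_neq0).
Qed.

Lemma piece_not_sub0 k : (0 < k <= n - 3)%N -> ~~ (A k <= 0)%VS.
Proof. by move/dim_piece_gt0; rewrite subv0 -dimv_eq0 lt0n. Qed.

(** If [e_(n-3)] sits high in the filtration, there are many nonzero pieces, and they
    are small because dimensions add up to [n]. *)
Lemma dim_piece_top k m : e (n - 3)%N \in tail m -> (1 < k <= m)%N ->
  (\dim (A k) + m <= n)%N.
Proof.
move=> em km; have k1 : 1%N != k by lia.
have sub : {subset [:: 1%N; k] <= index_iota 1 m.+1}.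
  by move=> i; rewrite !inE mem_index_iota => /orP[] /eqP ->; lia.
have := dim_piece_excess em _ sub; rewrite /= inE k1 => /(_ isT).
by rewrite !big_cons big_nil dim_piece1; lia.
Qed.

Lemma top_tail_lt m : (0 < m)%N -> e (n - 3)%N \in tail m -> (m < n)%N.
Proof.
move=> m0 em; have := @dim_piece_excess _ [:: 1%N] em isT.
rewrite big_cons big_nil dim_piece1 => h.
suff : {subset [:: 1%N] <= index_iota 1 m.+1} by move/h; lia.
by move=> i; rewrite inE mem_index_iota => /eqP ->.
Qed.

(** If [x x] vanished, antisymmetry in degree one would put [e_2] in degrees at least 4,
    so [e_(n-3)] in degrees at least [n - 1], and every piece from degree two on would be a
    line.  The Leibniz identity then kills degree 4 or degree 5, or moves
    [e_2] one degree further, which dimensions do not allow. *)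
Lemma square_neq0 : x ** x != 0.
Proof.
apply/negP => /eqP xx0.
have xy : x ** y = - u by have [c ->] := xy_eq; rewrite xx0 scaler0 add0r.
have yy : y ** y = 0 by have [c ->] := yy_eq; rewrite xx0 scaler0.
have xu : x ** u = - (u ** x) by rewrite leibD // xy xx0 !brE subr0.
have A2u : (A 2%N <= <[u]>)%VS.
  by apply: subv_trans piece2 _; rewrite xx0 add0v.
have [al y2] : exists al, pr 2%N (e 1%N) = al *: u.
  by apply/vlineP/(subvP A2u)/pr_mem.
have [e2_2 e2_3] := e2_parts; rewrite xx0 in e2_2; rewrite y2 !brE xu scalerN addNr in e2_3.
have e2_t4 : e 2%N \in tail 4.
  by apply/tailP => -[|[|[|[|//]]]] _ //; apply: (tailP _ _ e2_tail).
have n2 : (0 < 2 <= n - 3)%N by clear -n9; lia.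
have n4 : (0 < 4 <= n - 3)%N by clear -n9; lia.
have n5 : (0 < 5 <= n - 3)%N by clear -n9; lia.
have top_t : e (n - 3)%N \in tail (n - 1).
  have := top_tail n2 e2_t4; suff -> : (4 + (n - 3 - 2) = n - 1)%N by [].
  by clear -n9; lia.
have d34 k : (1 < k <= n - 1)%N -> (\dim (A k) <= 1)%N.
  by move/(dim_piece_top top_t); clear -n9; lia.
have d3 : (\dim (A 3%N) <= 1)%N by apply: d34; clear -n9; lia.
have d4 : (\dim (A 4%N) <= 1)%N by apply: d34; clear -n9; lia.
have A3 z : z \in A 2%N -> z ** x \in A 3%N by move=> z2; apply: (piece_mul grd z2 x_piece).
have A3' z : z \in A 2%N -> z ** y \in A 3%N by move=> z2; apply: (piece_mul grd z2 y_piece).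
(* First case: u x spans degree 3; it turns out that degree 4 vanishes. *)
have [ux0|ux0] := eqVneq (u ** x) 0; last first.
  have A3v := dim_le1_line (A3 _ u_piece) ux0 d3.
  have vx : u ** x ** x = 0 by apply: ypow3.
  have [q uy] : exists q, u ** y = q *: (u ** x).
    by apply/vlineP/(subvP A3v)/A3'/u_piece.
  have xv : x ** (u ** x) = 0 by rewrite leibD // xu xx0 !brE vx !oppr0 addr0.
  have uu : u ** u = q *: (u ** x ** x) - u ** x ** y by rewrite {2}/u leibD // uy !brE.
  have : x ** (u ** y) = 0 by rewrite uy !brE xv scaler0.
  rewrite leibD // xu xy !brE opprK uu vx scaler0 sub0r.
  move/eqP; rewrite -opprD oppr_eq0 -mulr2n natmul_eq0 => /eqP vy.
  apply: (negP (piece_not_sub0 n4)).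
  by apply: (piece_next_line grd piece1 A3v); rewrite ?vx ?vy mem0v.
(* Second case: u y spans degree 3, and w, if nonzero, spans degree 4. *)
pose v := u ** y; pose w := v ** x.
have A3v : (A 3%N <= <[v]>)%VS.
  by apply: (piece_next_line grd piece1 A2u); rewrite ?ux0 ?mem0v ?memv_line.
have uu : u ** u = w by rewrite {2}/u leibD // ux0 linear0l subr0.
have xv : x ** v = w by rewrite leibD // xu xy ux0 !brE oppr0 uu sub0r opprK.
have uxc z : z ** u ** x = z ** x ** u by apply: rann_comm => // t; rewrite ux0 linear0r.
have wx : w ** x = 0 by rewrite -uu uxc ux0 linear0l.
(* If w = 0, the degree 4 part of e_2 vanishes too, which is one degree too many. *)
have [w0|w0] := eqVneq w 0.
  have [k y3] : exists k, pr 3%N (e 1%N) = k *: v.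
    by apply/vlineP/(subvP A3v)/pr_mem.
  have e2_4 : pr 4%N (e 2%N) = 0.
    by rewrite e2_eq (pr4 grd) y2 y3 !brE uu xv -/w w0 !scaler0 !addr0.
  have e2_t5 : e 2%N \in tail 5.
    apply/tailP => k'; rewrite ltnS leq_eqVlt => /predU1P[-> //|].
    exact: (tailP _ _ e2_t4).
  have top_n : e (n - 3)%N \in tail n.
    have := top_tail n2 e2_t5; suff -> : (5 + (n - 3 - 2) = n)%N by [].
    by clear -n9; lia.
  have n0 : (0 < n)%N by clear -n9; lia.
  by have := top_tail_lt n0 top_n; rewrite ltnn.
have v_piece : v \in A 3%N by apply/A3'/u_piece.
have w_piece : w \in A 4%N by apply: (piece_mul grd v_piece x_piece).
have A4w := dim_le1_line w_piece w0 d4.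
have [k vy] : exists k, v ** y = k *: w.
  by apply/vlineP/(subvP A4w)/(piece_mul grd v_piece y_piece).
have rw : rann br w.
  move=> z; have := rann_sym leib x v z; rewrite xv -/w -mulr2n linearMnr /=.
  by move/eqP; rewrite natmul_eq0 => /eqP.
have vyc z : z ** v ** y = z ** y ** v.
  by apply: rann_comm => //; rewrite vy; apply: rannZ.
(* Comparing the two sides of x v y = x y v gives w y = - 2 w y, so degree 5 vanishes. *)
have vu : v ** u = - (w ** y) by rewrite {1}/u leibD // vy !brE wx scaler0 sub0r.
have uv : u ** v = w ** y + w ** y by rewrite {1}/v leibD // uu -/v vu opprK.
have := vyc x; rewrite xv xy !brE uv => /eqP; rewrite -subr_eq0 opprK.
rewrite -mulr2n -mulrS natmul_eq0 => /eqP wy.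
apply: (negP (piece_not_sub0 n5)).
by apply: (piece_next_line grd piece1 A4w); rewrite ?wx ?wy mem0v.
Qed.

Lemma dim_piece2 : \dim (A 2%N) = 2.
Proof.
apply/eqP; rewrite eqn_leq (leq_trans (dimvS piece2) (dim_plane_le _ _)) /=.
have u_line : u \notin <[x ** x]>%VS.
  apply: contra z0u => /vlineP[c uE]; rewrite -/u uE !brE.
  by rewrite (rann_sqr leib) scaler0.
rewrite -(dim_plane square_neq0 u_line); apply: dimvS.
rewrite subv_add -!memvE u_piece.
by rewrite (piece_mul grd x_piece x_piece).
Qed.

Lemma dim_tail3 : \dim (tail 3) = (n - 4)%N.
Proof. by have := dim_tail grd 2; rewrite dim_tail2 dim_piece2; lia. Qed.

Lemma piece3 : (A 3%N <= <[x ** x ** x]> + <[u ** x]>)%VS.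
Proof.
apply: subv_trans (limg_rmul_plane _ piece2); apply: piece_rho => //.
by rewrite dim_tail2 dim_tail3; lia.
Qed.

Lemma u_mulx : u ** x \in A 3%N. Proof. exact: (piece_mul grd u_piece x_piece). Qed.
Lemma u_muly : u ** y \in A 3%N. Proof. exact: (piece_mul grd u_piece y_piece). Qed.

Lemma leib_u z : z ** u = z ** y ** x - z ** x ** y.
Proof. exact: leibD. Qed.

(** Then all of degree three annihilates on the right, so [R_u] commutes with [R_x], and
    by induction every higher piece is the line of a power of [x]: these pieces are too
    few to reach dimension [n]. *)
Lemma long_line_absurd : (A 3%N <= <[x ^: 2]>)%VS -> False.
Proof.
move=> A3.
have rA3 a : a \in A 3%N -> rann br a.
  move/(subvP A3)/vlineP => [c ->]; apply: rannZ.
  by apply: (rann_mul leib); apply: rann_sqr.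
have ux z : z ** u ** x = z ** x ** u by apply/(rann_comm leib)/rA3/u_mulx.
have line_u k : x ^: k ** u \in <[x ^: k.+2]>%VS.
  elim: k => [|k IH]; first by apply/(subvP A3)/(piece_mul grd x_piece u_piece).
  rewrite rpowS -ux; case/vlineP: IH => c ->.
  by rewrite !brE -rpowS memvZ ?memv_line.
have line_y k : x ^: k.+1 ** y \in <[x ^: k.+2]>%VS.
  elim: k => [|k IH]; first by apply/(subvP A3)/(piece_mul grd (xpow_piece 1) y_piece).
  have -> : x ^: k.+2 ** y = x ^: k.+1 ** y ** x - x ^: k.+1 ** u.
    by rewrite leib_u opprB addrC subrK.
  rewrite memvB //; case/vlineP: IH => c ->.
  by rewrite !brE -rpowS memvZ ?memv_line.
have Ak k : (A k.+3 <= <[x ^: k.+2]>)%VS.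
  elim: k => [|k IH]; first exact: A3.
  by apply: (piece_next_line grd piece1 IH); rewrite ?line_y // -rpowS memv_line.
have A0 : A (n - 3).+1 = 0%VS.
  apply/eqP; rewrite -subv0; have -> : (n - 3).+1 = (n - 5).+3 by lia.
  apply: subv_trans (Ak _) _; have -> : (n - 5).+2 = (n - 3)%N by lia.
  by rewrite xpow_top -memvE mem0v.
have := dim_upper A0; rewrite dimV (big_cat_nat (n := 3)) //=; last by lia.
rewrite big_nat_recr //= big_nat1 dim_piece1 dim_piece2.
have : (\sum_(3 <= k < (n - 3).+1) \dim (A k) <= \sum_(3 <= k < (n - 3).+1) 1)%N.
  rewrite big_nat_cond [X in (_ <= X)%N]big_nat_cond; apply: leq_sum => -[|[|[|k]]] //; try lia.
  by move=> _; apply: dim_line_le (Ak k).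
rewrite sum_nat_const_nat; lia.
Qed.

(** Degree three is spanned by [v], with [v x = 0].  If [v] annihilates on the right,
    [R_u] and [R_x] commute and degree four vanishes.  Otherwise [x x y], a multiple of
    [v] which annihilates, is zero; then [e_3] lies in degrees at least 5, and there are
    too many nonzero pieces. *)
Lemma short_line_absurd : x ** x ** x = 0 -> False.
Proof.
move=> x30; have A3v : (A 3%N <= <[u ** x]>)%VS.
  by apply: subv_trans piece3 _; rewrite x30 add0v.
pose v := u ** x; have vx : v ** x = 0 by apply: ypow3.
have n4 : (0 < 4 <= n - 3)%N by clear -n9; lia.
have rv_absurd : rann br v -> False.
  move=> rv; apply: (negP (piece_not_sub0 n4)).
  have [c yu] : exists c, y ** u = c *: v.
    by apply/vlineP/(subvP A3v)/(piece_mul grd y_piece u_piece).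
  have [d uy] : exists d, u ** y = d *: v by apply/vlineP/(subvP A3v)/u_muly.
  have uu : u ** u = 0.
    by rewrite {1}/u -(rann_comm leib _ rv) yu !brE vx scaler0.
  apply: (piece_next_line grd piece1 A3v); rewrite -/v ?vx ?mem0v //.
  move: uu; rewrite leib_u uy !brE vx scaler0 sub0r => /eqP.
  by rewrite oppr_eq0 => /eqP ->; rewrite mem0v.
have x2y : x ** x ** y = 0.
  have [c cE] : exists c, x ** x ** y = c *: v.
    apply/vlineP/(subvP A3v); exact: (piece_mul grd (xpow_piece 1) y_piece).
  have [c0|c0] := eqVneq c 0; first by rewrite cE c0 scale0r.
  case: rv_absurd => z; have := rann_mul leib y (rann_sqr leib x) z.
  by rewrite cE !brE => /eqP; rewrite scaler_eq0 (negPf c0) => /eqP.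
have [al [be y2]] : exists al be, pr 2%N (e 1%N) = al *: (x ** x) + be *: u.
  by apply/memv_plane/(subvP piece2)/pr_mem.
have [c xy] := xy_eq.
have [e2_2 e2_3] := e2_parts.
have {}e2_3 : pr 3%N (e 2%N) = 0.
  rewrite e2_3 y2 !brE (rann_sqr leib) x30 leib_u xy !brE x30 x2y.
  by rewrite !scaler0 !subr0 !add0r -scalerDr addrC subrr scaler0.
have e3E : e 3%N = e 2%N ** e 1%N by rewrite eS //; clear -n9; lia.
have e3_t : e 3%N \in tail 5.
  have [t3 p3] := rho_tail e2_tail; rewrite rhoE -e3E in t3 p3.
  apply/tailP => -[|[|[|[|[|//]]]]] _; try exact: (tailP _ _ t3).
    by rewrite p3 e2_2.
  rewrite e3E (pr4 grd) e2_2 e2_3 y2 (tailP _ _ e2_tail) // !brE.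
  by rewrite (rann_sqr leib) leib_u x2y x30 !brE subrr !scaler0 !addr0.
have n3 : (0 < 3 <= n - 3)%N by clear -n9; lia.
have top_t : e (n - 3)%N \in tail (n - 1).
  have := top_tail n3 e3_t; suff -> : (5 + (n - 3 - 3) = n - 1)%N by [].
  by clear -n9; lia.
have : (1 < 2 <= n - 1)%N by clear -n9; lia.
by move/(dim_piece_top top_t); rewrite dim_piece2; clear -n9; lia.
Qed.

(** Once degrees one, two and three have dimension 2, the [n - 6] dimensions left are
    shared by the pieces of degrees 4 to [n - 3], all nonzero: they are lines, and
    [e_(n-3)] is homogeneous, equal to a nonzero power of [x]. *)
Lemma two_chains_noncomm : two_chains.
Proof.
split; first exact: piece3.
have [d3|d3] := leqP (\dim (A 3%N)) 1.
  have [/eqP x3|x3] := boolP (x ** x ** x == 0); first by case: (short_line_absurd x3).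
  by case: long_line_absurd; apply: dim_le1_line d3; rewrite ?xpow_piece.
have [|en prE] := @pr_e (n - 4); first by lia.
have topE : (n - 4).+1 = (n - 3)%N by lia.
rewrite topE in en prE.
have rsub r : all (fun k => 0 < k <= n - 3)%N r -> {subset r <= index_iota 1 (n - 3).+1}.
  by move=> /allP h k /h; rewrite mem_index_iota ltnS.
have d4 k : (4 <= k <= n - 3)%N -> (\dim (A k) <= 1)%N.
  move=> k4; have := @dim_piece_excess _ [:: 1; 2; 3; k]%N en _ (rsub _ _).
  rewrite !big_cons big_nil dim_piece1 dim_piece2 => h.
  have k123 : (k \notin [:: 1; 2; 3]%N) by rewrite !inE; lia.
  have {}h := h _ _; move: h; rewrite /= !inE; lia.
have tail0 : tail (n - 2) = 0%VS.
  apply/eqP; rewrite -dimv_eq0.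
  have := @dim_piece_excess _ [:: 1; 2; 3]%N en isT (rsub _ _).
  rewrite !big_cons big_nil dim_piece1 dim_piece2 => h.
  have {}h := h _; move: h; have -> : (n - 3).+1 = (n - 2)%N by lia.
  rewrite /=; lia.
have xtop : x ^: (n - 4) != 0.
  rewrite -prE; have := tail_next grd en; have -> : (n - 3).+1 = (n - 2)%N by lia.
  by rewrite tail0 memv0 subr_eq0 => /eqP <-; apply: e_top_neq0.
move=> k k3; have [kn|kn] := leqP k (n - 4); last first.
  apply: subv_trans (sub0v _); rewrite -tail0; apply/subvP => z.
  move/(piece_tail grd)/tailP => zk; apply/tailP => i ik; apply: zk; lia.
apply: dim_le1_line (xpow_piece k) _ (d4 _ _); last by lia.
by apply: contraNneq xtop => /(rpow_eq0 kn) ->.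
Qed.
End NonCommuting.

Lemma two_chains_hold : two_chains.
Proof.
have [/allP ru|] := boolP (all (fun z => z ** (y ** x) == 0) (vbasis fullv)).
  apply: two_chains_comm => z; rewrite (coord_vbasis (memvf z)) linear_sumlz big1 // => i _.
  by rewrite linearZl_LR (eqP (ru _ _)) ?scaler0 // mem_nth ?size_tuple.
by case/allPn => z0 _; apply: two_chains_noncomm.
Qed.

Lemma chain_basis : basis_of fullv [seq chain n br x y i | i <- iota 1 n].
Proof.
have [A3 Ak] := two_chains_hold.
rewrite basisEdim size_map size_iota dimV leqnn andbT.
set W := (<<_>>)%VS.
have xW k : x ^: k \in W.
  have [kn|kn] := ltnP k (n - 3); last by rewrite (rpow_eq0 kn xpow_top) mem0v.
  apply: memv_span; apply/mapP; exists k.+1; first by rewrite mem_iota; lia.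
  by rewrite /chain kn.
have yW k : rpow br x y k \in W.
  have [kn|kn] := ltnP k 3; last by rewrite (rpow_eq0 kn ypow3) mem0v.
  apply: memv_span; apply/mapP; exists (n - 2 + k)%N; first by rewrite mem_iota; lia.
  by rewrite /chain ifN ?addKn //; lia.
have planeW k : (<[x ^: k]> + <[rpow br x y k]> <= W)%VS.
  by rewrite subv_add -!memvE xW yW.
apply/subvP => z _; rewrite (pr_sum grd z); apply: memv_suml => -[[|k] ks] _ /=.
  by rewrite (pr0 grd) mem0v.
suff kW : (A k.+1 <= W)%VS by apply: (subvP kW); apply: pr_mem.
case: k {ks} => [|[|[|k]]].
- exact: subv_trans piece1 (planeW 0%N).
- exact: subv_trans piece2 (planeW 1%N).
- exact: subv_trans A3 (planeW 2).
- by apply: subv_trans (Ak _ _) _; rewrite // -memvE xW.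
Qed.

Lemma graded_chains_hold : graded_chains n br x y.
Proof.
have [A3 Ak] := two_chains_hold.
have x2 : x ** x \in A 2%N by apply: (piece_mul grd x_piece x_piece).
have yx : y ** x \in A 2%N by apply: (piece_mul grd y_piece x_piece).
split=> [|||||||k k2|].
- exact: chain_basis.
- exact: xpow_top.
- exact: ypow3.
- by apply/(subvP piece2)/(piece_mul grd x_piece y_piece).
- by apply/(subvP piece2)/(piece_mul grd y_piece y_piece).
- by apply/(subvP A3)/(piece_mul grd x2 y_piece).
- by apply/(subvP A3)/(piece_mul grd yx y_piece).
- apply/(subvP (Ak k.+1 _)); first by lia.
  by have := piece_mul grd (xpow_piece k) y_piece; rewrite addn1.
- by apply/(subvP (Ak 3 isT))/(piece_mul grd (piece_mul grd yx x_piece) y_piece).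
Qed.
End Structure.

Lemma first_type_chains {F : numFieldType} {V : vectType F}
    (br : {bilinear V -> V -> V}) n : (9 <= n)%N -> \dim {:V} = n ->
  leibniz br -> naturally_graded br -> first_type br n ->
  exists x y, graded_chains n br x y.
Proof.
move=> n9 dimV leib /(naturally_graded_grading leib)[s [pr grd]] [e [eb e1 eS e1e e2e]].
do 2!eexists; exact: (graded_chains_hold n9 dimV leib grd eb e1 eS e1e e2e).
Qed.

(** * The five structure constants *)

(** The action of [y] on the basis formed by the two chains.  The remaining products
    follow by the Leibniz identity ([adapted_table]). *)
Record adapted {F : fieldType} {V : vectType F} (n : nat)
    (br : {bilinear V -> V -> V}) (x y : V) (al be be2 d mu : F) : Prop := Adapted {
  ad_basis : basis_of fullv [seq chain n br x y i | i <- iota 1 n];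
  ad_xtop : rpow br x x (n - 3) = 0;
  ad_ytop : br (br (br y x) x) x = 0;
  ad_xy : br x y = al *: br x x + be *: br y x;
  ad_x2y : br (br x x) y = al *: br (br x x) x + (be - mu) *: br (br y x) x;
  ad_xky : forall k, (2 <= k)%N -> br (rpow br x x k) y = al *: rpow br x x k.+1;
  ad_yy : br y y = be2 *: br y x;
  ad_uy : br (br y x) y = d *: br (br y x) x;
  ad_vy : br (br (br y x) x) y = 0 }.

Section Independence.
Context {F : fieldType} {V : vectType F}.

Lemma basis_neq0 (c : nat -> V) n i :
  basis_of fullv [seq c i | i <- iota 1 n] -> (0 < i <= n)%N -> c i != 0.
Proof.
move=> /basis_free fX iN; apply: contraTneq fX => c0; apply/negP => /free_not0 h.
have : 0 \in [seq c i | i <- iota 1 n] by rewrite -c0 map_f // mem_iota; lia.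
by move/h; rewrite eqxx.
Qed.

Lemma scaler_inj (z : V) (a b : F) : z != 0 -> a *: z = b *: z -> a = b.
Proof.
by move=> z0 /eqP; rewrite -subr_eq0 -scalerBl scaler_eq0 (negPf z0) orbF subr_eq0 => /eqP.
Qed.
End Independence.

Lemma eq_scaled {F : pzRingType} (k p q l r : F) : p = q -> l - r = k * (p - q) -> l = r.
Proof. by move=> ->; rewrite subrr mulr0 => /eqP; rewrite subr_eq0 => /eqP. Qed.

(** The equations come from [adapted_noncomm], where [ep] and [de] are the coefficients of
    [x v] and [v v].  When [de] is nonzero they are all solved in terms of [ep], with
    [a = 15 ep] and [g5 = 3 ep]; the equation [ep g5 = a ep] then forces [ep = 0] and so
    [de = 0].  When [de = 0], a nonzero [ep] gives [g4 = al] and [g5 = a], and the three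
    second differences of [al, a, g3, g4, g5], each equal to [ep], add up to zero. *)
Lemma no_deep_annihilator {F : numFieldType} (al al2 a b c d de ep g3 g4 g5 : F) :
  ep = al - 2 * a + g3 -> a - 2 * g3 + g4 = ep -> g3 - 2 * g4 + g5 = ep ->
  c = 3 * de -> al2 = 6 * de ->
  ep * g4 = al * ep - de -> de * g4 = 6 * de * ep ->
  ep * g5 = a * ep + b * de -> de * g5 = 3 * de * ep + d * de ->
  de * (g5 - (g4 - g5)) = d * de -> b * de = 0 ->
  de = 0 /\ ep = 0.
Proof.
move=> e1 e2 e3 _ _ e4 e5 e6 e7 e8 bde.
have de0 : de = 0.
  apply/eqP; apply/negP => /negP de0.
  have {}e5 : g4 = 6 * ep by apply: (mulfI de0); rewrite e5; ring.
  have {}e7 : g5 = 3 * ep + d by apply: (mulfI de0); rewrite e7; ring.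
  have {}e8 : g5 - (g4 - g5) = d by apply: (mulfI de0); rewrite e8; ring.
  have d0 : d = 0 by apply: (eq_scaled (k := 1) e8); rewrite e7 e5; ring.
  have g3E : g3 = 10 * ep by apply: (eq_scaled (k := 1) e3); rewrite e7 e5 d0; ring.
  have aE : a = 15 * ep by apply: (eq_scaled (k := 1) e2); rewrite g3E e5; ring.
  have : 12 * (ep * ep) = 0.
    apply: (eq_scaled (k := -1) e6); rewrite bde e7 aE d0; ring.
  move/eqP; rewrite !mulf_eq0 Num.Theory.pnatr_eq0 /= orbb => /eqP ep0.
  move/eqP: de0; apply; apply: (eq_scaled (k := 1) e4).
  by rewrite ep0; ring.
split=> //; apply/eqP; apply/negP => /negP ep0.
have {}e4 : g4 = al by apply: (mulfI ep0); rewrite e4 de0; ring.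
have {}e6 : g5 = a by apply: (mulfI ep0); rewrite e6 de0; ring.
have : 3 * ep = 0.
  have E : (al - 2 * a + g3) + (a - 2 * g3 + g4) + (g3 - 2 * g4 + g5) = ep + ep + ep.
    by rewrite e2 e3 -e1.
  by apply: (eq_scaled (k := -1) E); rewrite e4 e6; ring.
by move/eqP; rewrite mulf_eq0 Num.Theory.pnatr_eq0 (negPf ep0).
Qed.

Section StructureConstants.
Context {F : numFieldType} {V : vectType F} {br : {bilinear V -> V -> V}}.
Local Notation "a ** b" := (br a b) (at level 40, left associativity).
Local Notation "x ^: k" := (rpow br x x k) (at level 30).
Context {n : nat} (n9 : (9 <= n)%N) (leib : leibniz br).
Context {x y : V} (gc : graded_chains n br x y).
Let u := y ** x.
Let v := u ** x.

Lemma xpow_neq0 k : (k < n - 3)%N -> x ^: k != 0.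
Proof.
move=> kn; have := basis_neq0 (gc_basis gc) (i := k.+1).
by rewrite /chain kn; apply; lia.
Qed.

Lemma leib_y z : z ** u = z ** y ** x - z ** x ** y. Proof. exact: leibD. Qed.
Lemma leib_v z : z ** v = z ** u ** x - z ** x ** u. Proof. exact: leibD. Qed.
Lemma vx0 : v ** x = 0. Proof. exact: gc_ytop gc. Qed.

Lemma rann_xpow k : rann br (x ^: k.+1).
Proof.
by elim: k => [|k IH]; [apply: rann_sqr | rewrite rpowS; apply: rann_mul].
Qed.

(** [R_y] commutes with [R_x], so its values on [x] and [y] propagate along the chains;
    [v x = 0] excludes a component of [y y] along [x x]. *)
Lemma adapted_comm : rann br u ->
  exists al be be2, adapted n br x y al be be2 be2 0.
Proof.
move=> ru; have comm z : z ** x ** y = z ** y ** x.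
  by rewrite (rann_comm leib _ ru).
have [al [be xy]] := memv_plane (gc_xy gc).
have [al2 [be2 yy]] := memv_plane (gc_yy gc).
(* The component is seen four steps further, where v x y = 0. *)
have al20 : al2 = 0.
  have : v ** y ** x = 0 by rewrite -comm vx0 linear0l.
  rewrite /v !comm yy !brE -/u -/v vx0 linear0l scaler0 addr0 => /eqP.
  rewrite scaler_eq0 (negPf (_ : x ** x ** x ** x ** x != 0)) ?orbF => [/eqP //|].
  by apply: (@xpow_neq0 4); lia.
rewrite al20 scale0r add0r in yy.
exists al, be, be2; split.
- exact: gc_basis gc.
- exact: gc_xtop gc.
- exact: vx0.
- exact: xy.
- by rewrite comm xy subr0 !brE.
- elim=> // -[|[|k]] IH _ //; first by rewrite rpowS !comm xy !brE -/u -/v vx0 scaler0 addr0.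
  by rewrite rpowS comm IH // !brE.
- exact: yy.
- by rewrite comm yy !brE.
- by rewrite !comm yy !brE -/u -/v vx0 scaler0.
Qed.

(** The right multiplications by [u] and [v] are computed from the unknown action of [y].
    As [v x = 0] and [v y] is a multiple of a power of [x], [R_v] commutes with [R_x] and [R_y], and the
    resulting relations show that [v] annihilates all powers of [x] and [v] itself.  Then
    [R_u] commutes with [R_y] on the powers of [x], which forces [y] to act on all
    of them by one scalar. *)
Lemma adapted_noncomm z0 : z0 ** u != 0 ->
  exists al d mu, adapted n br x y al (-1) 0 d mu.
Proof.
move=> z0u.
have [al [be xy]] := memv_plane (gc_xy gc); rewrite -/u in xy.
have beE : be = -1.
  have := rann_sym leib x y z0; rewrite -/u xy !brE (rann_sqr leib) scaler0 add0r => /eqP.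
  rewrite -[X in _ + X]scale1r -scalerDl scaler_eq0 (negPf z0u) orbF addr_eq0 => /eqP //.
rewrite {be}beE scaleN1r in xy.
have [al2 [be2 yy]] := memv_plane (gc_yy gc); rewrite -/u in yy.
have be20 : be2 = 0.
  have := rann_sqr leib y z0; rewrite yy !brE (rann_sqr leib) scaler0 add0r => /eqP.
  by rewrite scaler_eq0 (negPf z0u) orbF => /eqP.
rewrite {be2}be20 scale0r addr0 in yy.
have [a [b x1y]] := memv_plane (gc_x2y gc); rewrite -/u -/v in x1y.
have [c [d uy]] := memv_plane (gc_uy gc); rewrite -/u -/v in uy.
have /vlineP[de vy] := gc_vy gc; rewrite -/u -/v in vy.
have /vlineP[g3 x2y] := gc_xky gc (isT : 2 <= 2)%N.
have /vlineP[g4 x3y] := gc_xky gc (isT : 2 <= 3)%N.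
have /vlineP[g5 x4y] := gc_xky gc (isT : 2 <= 4)%N.
have x1E : x ** x = x ^: 1 by [].
have xS k : x ^: k ** x = x ^: k.+1 by [].
rewrite x1E ?xS in xy yy x1y uy.
have X4 : x ^: 4 != 0 by apply: xpow_neq0; lia.
have X5 : x ^: 5 != 0 by apply: xpow_neq0; lia.
have X3 : x ^: 3 != 0 by apply: xpow_neq0; lia.
have xu : x ** u = (al - a) *: x ^: 2 - (1 + b) *: v.
  rewrite leib_y xy x1E x1y !brE !xS -/v scalerBl scalerDl scale1r.
  by rewrite !opprD !addrA; congr (_ - _); rewrite addrAC.
have yu : y ** u = (al2 - c) *: x ^: 2 - d *: v.
  by rewrite leib_y yy -/u uy !brE !xS scalerBl opprD addrA.
have x1u : x ^: 1 ** u = (a - g3) *: x ^: 3.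
  by rewrite leib_y x1y xS x2y !brE !xS vx0 scaler0 addr0 scalerBl.
have x2u : x ^: 2 ** u = (g3 - g4) *: x ^: 4.
  by rewrite leib_y x2y xS x3y !brE !xS scalerBl.
have x3u : x ^: 3 ** u = (g4 - g5) *: x ^: 5.
  by rewrite leib_y x3y xS x4y !brE !xS scalerBl.
have uu : u ** u = (c - de) *: x ^: 3.
  by rewrite leib_y uy -/v vy !brE !xS vx0 scaler0 addr0 scalerBl.
have vu : v ** u = de *: x ^: 4.
  by rewrite leib_y vy vx0 !brE !xS subr0.
have xv : x ** v = (al - 2 * a + g3) *: x ^: 3.
  rewrite leib_v xu x1E x1u !brE !xS vx0 scaler0 oppr0 addr0 -scalerBl.
  by congr (_ *: _); ring.
have yv : y ** v = (al2 - 2 * c + de) *: x ^: 3.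
  rewrite leib_v yu -/u uu !brE !xS vx0 scaler0 oppr0 addr0 -scalerBl.
  by congr (_ *: _); ring.
have x1v : x ^: 1 ** v = (a - 2 * g3 + g4) *: x ^: 4.
  rewrite leib_v x1u xS x2u !brE !xS -scalerBl.
  by congr (_ *: _); ring.
have x2v : x ^: 2 ** v = (g3 - 2 * g4 + g5) *: x ^: 5.
  rewrite leib_v x2u xS x3u !brE !xS -scalerBl.
  by congr (_ *: _); ring.
have uv : u ** v = (c - 2 * de) *: x ^: 4.
  rewrite leib_v uu -/v vu !brE !xS -scalerBl.
  by congr (_ *: _); ring.
have vv : v ** v = de *: x ^: 5.
  by rewrite leib_v vu vx0 !brE !xS subr0.
have vxc z : z ** v ** x = z ** x ** v.
  by apply: rann_comm => // t; rewrite vx0 linear0r.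
have vyc z : z ** v ** y = z ** y ** v.
  by apply: rann_comm => //; rewrite vy; apply/rannZ/rann_xpow.
have uyc z : z ** u ** y = z ** y ** u + d *: (z ** v).
  have := leibD leib z u y; rewrite uy !brE rann_xpow scaler0 add0r => ->.
  by rewrite addrC subrK.
(* x u + u x annihilates, and its only component off the powers of x is - b v. *)
have bv z : b *: (z ** v) = 0.
  have := rann_sym leib x u z; rewrite xu -/v !brE rann_xpow scaler0 add0r.
  by rewrite scalerDl scale1r opprD addrAC addNr add0r => /eqP; rewrite oppr_eq0 => /eqP.
pose ep := al - 2 * a + g3.
have E1 : a - 2 * g3 + g4 = ep.
  by apply: (scaler_inj X4); rewrite -x1v -x1E -vxc xv linearZl_LR.
have E2 : g3 - 2 * g4 + g5 = ep.
  by apply: (scaler_inj X5); rewrite -x2v -xS -vxc x1v linearZl_LR E1.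
have E3 : c - 2 * de = al2 - 2 * c + de.
  by apply: (scaler_inj X4); rewrite -uv -vxc yv linearZl_LR.
have E4 : de = c - 2 * de.
  by apply: (scaler_inj X5); rewrite -vv -vxc uv linearZl_LR.
have cE : c = 3 * de by apply: (eq_scaled (k := -1) E4); ring.
have al2E : al2 = 6 * de by apply: (eq_scaled (k := -1) E3); rewrite cE; ring.
have E5 : ep * g4 = al * ep - de.
  apply: (scaler_inj X4); have := vyc x; rewrite xv xy !brE x3y x1v E1 uv -E4 !scalerA => ->.
  by rewrite scalerBl.
have E6 : de * g4 = 6 * de * ep.
  apply: (scaler_inj X4); have := vyc y; rewrite yv yy !brE x3y x1v E1 !scalerA -E3 -E4 al2E.
  by move->.
have E7 : ep * g5 = a * ep + b * de.
  apply: (scaler_inj X5); have := vyc (x ^: 1); rewrite x1v x1y !brE x4y x2v E1 E2 vv !scalerA => ->.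
  by rewrite scalerDl.
have E8 : de * g5 = 3 * de * ep + d * de.
  apply: (scaler_inj X5); have := vyc u; rewrite uv uy !brE x4y x2v E2 vv !scalerA -E4 cE => ->.
  by rewrite scalerDl.
have E9 : de * (g5 - (g4 - g5)) = d * de.
  apply: (scaler_inj X5); have := uyc v; rewrite vu vy vv !brE x4y x3u !scalerA => E.
  by rewrite mulrBr scalerBl E addrC addKr.
have bde : b * de = 0.
  by apply: (scaler_inj X5); rewrite -scalerA -vv bv scale0r.
have [de0 ep0] := no_deep_annihilator (ep := ep) erefl E1 E2 cE al2E E5 E6 E7 E8 E9 bde.
rewrite {}de0 ?mulr0 in cE al2E uv vu vv vy E3 E4 E5 E6 E7 E8 E9 bde uu.
rewrite ep0 in E1 E2.
rewrite -/ep ep0 scale0r in xv.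
(* a, g3, g4 are now in arithmetic progression, and the difference has zero square. *)
have tau : g3 = a.
  have g4E : g4 = 2 * g3 - a by apply: (eq_scaled (k := 1) E1); ring.
  have E : (a - g3) * g4 = a * (g3 - g4).
    apply: (scaler_inj X4); have := uyc (x ^: 1).
    by rewrite x1u x1y x1v E1 scale0r scaler0 addr0 !brE x3y x2u vu scale0r scaler0 addr0 !scalerA.
  have : 2 * ((a - g3) * (a - g3)) = 0.
    by apply: (eq_scaled (k := -1) E); rewrite g4E; ring.
  by move/eqP; rewrite !mulf_eq0 Num.Theory.pnatr_eq0 /= orbb subr_eq0 => /eqP.
have alE : al = a.
  by move: ep0; rewrite /ep tau => h; apply: (eq_scaled (k := 1) h); ring.
rewrite tau in x2y x1u.
have xkv k : x ^: k ** v = 0 by elim: k => // k IH; rewrite rpowS -vxc IH linear0l.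
have xku k : x ^: k.+1 ** u = 0.
  elim: k => [|k IH]; first by rewrite x1u subrr scale0r.
  have := xkv k.+1; rewrite leib_v IH linear0l sub0r => /eqP.
  by rewrite oppr_eq0 => /eqP.
exists al, d, (-1 - b); split.
- exact: gc_basis gc.
- exact: gc_xtop gc.
- exact: vx0.
- by rewrite xy scaleN1r.
- by rewrite x1E x1y alE opprB addrCA subrr addr0.
- elim=> // -[|[|k]] IH _ //; first by rewrite x2y alE.
  have := xku k.+1; rewrite leib_y IH // -xS linearZl_LR /= => /eqP.
  by rewrite subr_eq0 => /eqP <-.
- by rewrite yy al2E scale0r scale0r.
- by rewrite uy cE scale0r add0r.
- by rewrite vy scale0r.
Qed.

Lemma graded_chains_adapted :
  exists al be be2 d mu, adapted n br x y al be be2 d mu /\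
    ((d = be2 /\ mu = 0) \/ (be = -1 /\ be2 = 0)).
Proof.
have [/allP ru|] := boolP (all (fun z => z ** u == 0) (vbasis fullv)).
  have [|al [be [be2 ad]]] := adapted_comm.
    move=> z; rewrite (coord_vbasis (memvf z)) linear_sumlz big1 // => i _.
    by rewrite linearZl_LR (eqP (ru _ _)) ?scaler0 // mem_nth ?size_tuple.
  by exists al, be, be2, be2, 0; split=> //; left.
case/allPn => z0 _ /adapted_noncomm[al [d [mu ad]]].
by exists al, (-1), 0, d, mu; split=> //; right.
Qed.
End StructureConstants.

(** * Change of generators and normal forms *)

(** How the five scalars change when [x, y] is replaced by [A x + B y, Q y].  The
    equations are kept free of denominators. *)
Definition coeff_change {F : fieldType} (A B Q : F) (c c' : F * F * F * F * F) : Prop :=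
  let: (al, be, be2, d, mu) := c in let: (al', be', be2', d', mu') := c' in
  [/\ (A + B * al) * al' = Q * al, (A + B * be2) * be2' = Q * be2,
      (A + B * d) * d' = Q * d, (A + B * d) * mu' = A * mu + B * (be2 - d)
    & (A + B * al) * (A + B * be2) * be' = A * (A * be + B * (be2 - al))].

Definition change_nondeg {F : fieldType} (A B Q : F) (c : F * F * F * F * F) : Prop :=
  let: (al, be, be2, d, mu) := c in
  [/\ A != 0, Q != 0, A + B * al != 0, A + B * be2 != 0 & A + B * d != 0].

(** The scalars [al], [be2], [d] are brought to 0, 1, 2 or -1 according to which of
    them vanish or coincide; the freedom left in [B / A] then normalises [be] or [mu],
    except where they are invariants of the algebra. *)
Lemma exists_listed_coeff (F : numClosedFieldType) (al be be2 d mu : F) :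
  (d = be2 /\ mu = 0) \/ (be = -1 /\ be2 = 0) ->
  exists t A B Q, [/\ admissible t, change_nondeg A B Q (al, be, be2, d, mu)
    & coeff_change A B Q (al, be, be2, d, mu) (coefficients t)].
Proof.
have n20 : 2 != 0 :> F by rewrite Num.Theory.pnatr_eq0.
have sol (t : listed F) A B Q : admissible t -> change_nondeg A B Q (al, be, be2, d, mu) ->
    coeff_change A B Q (al, be, be2, d, mu) (coefficients t) ->
  exists t A B Q, [/\ admissible t, change_nondeg A B Q (al, be, be2, d, mu)
    & coeff_change A B Q (al, be, be2, d, mu) (coefficients t)].
  by move=> *; exists t, A, B, Q; split.
have N1 : 1 != 0 :> F := oner_neq0 F.
case=> [[dE muE]|[beE be2E]]; subst.
  have [al0|al0] := eqVneq al 0; have [b0|b0] := eqVneq be2 0; subst.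
  - apply: (sol (L34 be) 1 0 1) => //=; first by rewrite !mul0r addr0.
    by split; ring.
  - have [be1|be1] := eqVneq be 1; subst.
      apply: (sol (L35 0 1) 1 0 be2^-1); rewrite /= ?inE ?eqxx ?orbT //.
        by rewrite !mul0r addr0 invr_eq0.
      by split; field.
    have e1 : 1 - be != 0 by rewrite subr_eq0 eq_sym.
    have e2 : 1 + - (be / be2) * be2 = 1 - be by field.
    apply: (sol (L35 0 0) 1 (- (be / be2)) ((1 - be) / be2)); rewrite /= ?inE ?eqxx //.
      by rewrite e2 mulr0 addr0 mulf_neq0 ?invr_neq0.
    by split; field.
  - have [be1|be1] := eqVneq be (-1); subst.
      apply: (sol (L36 (-1)) 1 0 al^-1); rewrite /= ?inE ?eqxx //.
        by rewrite !mul0r addr0 invr_eq0.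
      by split; field.
    have e1 : 1 + be != 0 by rewrite addrC addr_eq0.
    have e2 : 1 + be / al * al = 1 + be by field.
    apply: (sol (L36 0) 1 (be / al) ((1 + be) / al)); rewrite /= ?inE ?eqxx ?orbT //.
      by rewrite e2 mulr0 addr0 mulf_neq0 ?invr_neq0.
    by split; field.
  have [E|ne] := eqVneq al be2; subst.
    have [be0|be0] := eqVneq be 0; subst.
      apply: (sol (L35 1 0) 1 0 be2^-1); rewrite /= ?inE ?eqxx ?orbT //.
        by rewrite !mul0r addr0 invr_eq0.
      by split; field.
    (* Here be' = (A / (A + B al))^2 be, so with A = 1 the value 1 + B al is a square root of be. *)
    have [r rr] : exists r, r ^+ 2 = be by eexists; apply: Num.Theory.sqrtCK.
    have r0 : r != 0 by apply: contraNneq be0 => r0; rewrite -rr r0 expr0n.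
    have e2 : 1 + (r - 1) / be2 * be2 = r by field.
    apply: (sol (L35 1 1) 1 ((r - 1) / be2) (r / be2)); rewrite /= ?inE ?eqxx ?orbT //.
      by rewrite e2 mulf_neq0 ?invr_neq0.
    by split; rewrite ?e2 -?rr; field.
  have e1 : al - be2 != 0 by rewrite subr_eq0.
  (* The solution of A + B al = Q al and 2 (A + B be2) = Q be2 with Q = al - be2. *)
  pose A := - (al * be2 / 2); pose B := al - be2 / 2.
  have eA : A != 0 by rewrite oppr_eq0 !mulf_neq0 ?invr_neq0.
  have e2 : A + B * al = al * (al - be2) by rewrite /A /B; field.
  have e3 : A + B * be2 = (al - be2) * be2 / 2 by rewrite /A /B; field.
  apply: (sol (L37 (A * (A * be + B * (be2 - al)) /
    ((A + B * al) * (A + B * be2)))) A B (al - be2)); rewrite //=.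
    by rewrite e2 e3 !mulf_neq0 ?invr_neq0.
  split; rewrite ?e2 ?e3 /A /B; field; rewrite ?n20 ?e1 ?al0 ?b0 //.
have [d0|d0] := eqVneq d 0; subst.
  have [al0|al0] := eqVneq al 0; subst.
    apply: (sol (L38 mu) 1 0 1) => //=; first by rewrite !mul0r addr0.
    by split; ring.
  apply: (sol (L40 0 mu) 1 0 al^-1); rewrite /= ?inE ?eqxx //.
    by rewrite !mul0r addr0 invr_eq0.
  by split; field.
have [al0|al0] := eqVneq al 0; subst.
  have [mu1|mu1] := eqVneq mu (-1); subst.
    apply: (sol (L39 (-1)) 1 0 (- d^-1)); rewrite /= ?inE ?eqxx //.
      by rewrite !mul0r addr0 oppr_eq0 invr_eq0.
    by split; field.
  have e1 : 1 + mu != 0 by rewrite addrC addr_eq0.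
  have e2 : 1 + mu / d * d = 1 + mu by field.
  apply: (sol (L39 0) 1 (mu / d) (- ((1 + mu) / d))); rewrite /= ?inE ?eqxx ?orbT //.
    by rewrite e2 mulr0 addr0 oppr_eq0 mulf_neq0 ?invr_neq0.
  by split; field.
have [E|ne] := eqVneq al d; subst.
  have [mu1|mu1] := eqVneq mu (-1); subst.
    apply: (sol (L41 (-1)) 1 0 d^-1); rewrite /= ?inE ?eqxx //.
      by rewrite !mul0r addr0 invr_eq0.
    by split; field.
  have e1 : 1 + mu != 0 by rewrite addrC addr_eq0.
  have e2 : 1 + mu / d * d = 1 + mu by field.
  apply: (sol (L41 0) 1 (mu / d) ((1 + mu) / d)); rewrite /= ?inE ?eqxx ?orbT //.
    by rewrite e2 mulr0 addr0 mulf_neq0 ?invr_neq0.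
  by split; field.
have e1 : al - d != 0 by rewrite subr_eq0.
(* The solution of A + B al = Q al and A + B d = - Q d with Q = al - d. *)
pose A := - (2 * al * d); pose B := al + d.
have eA : A != 0 by rewrite oppr_eq0 !mulf_neq0.
have e2 : A + B * al = al * (al - d) by rewrite /A /B; ring.
have e3 : A + B * d = - ((al - d) * d) by rewrite /A /B; ring.
apply: (sol (L40 1 ((A * mu - B * d) / (A + B * d))) A B (al - d));
  rewrite /= ?inE ?eqxx ?orbT //.
  rewrite e2 e3 mulr0 addr0; split=> //; rewrite ?oppr_eq0 ?mulf_neq0 //.
by split; rewrite ?e2 ?e3 /A /B; field; rewrite ?oppr_eq0 ?mulf_neq0 ?e1 ?al0 ?d0 //.
Qed.

(** The map [L] is left abstract so that identities between combinations of two vectors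
    can be reduced, by rewriting, to identities between their coefficients. *)
Lemma plane_coordinates {F : fieldType} {V : vectType F} (w1 w2 : V) :
  exists L : F -> F -> V,
    [/\ forall a b c d, L a b + L c d = L (a + c) (b + d),
        forall k a b, k *: L a b = L (k * a) (k * b), w1 = L 1 0 & w2 = L 0 1].
Proof.
exists (fun a b => a *: w1 + b *: w2); split=> [a b c d|k a b||].
- by rewrite !scalerDl addrACA.
- by rewrite scalerDr !scalerA.
- by rewrite scale1r scale0r addr0.
- by rewrite scale1r scale0r add0r.
Qed.

Section ChangeOfGenerators.
Context {F : numFieldType} {V : vectType F} {br : {bilinear V -> V -> V}}.
Local Notation "a ** b" := (br a b) (at level 40, left associativity).
Context {n : nat} (n9 : (9 <= n)%N) (dimV : \dim {:V} = n).

(** Multiplication by [A x + B y] acts on the two chains in a triangular way, with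
    diagonal factors [A], [A + B al], [A + B be2] and [A + B d]. *)
Lemma adapted_change x y al be be2 d mu A B Q al' be' be2' d' mu' :
  adapted n br x y al be be2 d mu ->
  (d = be2 /\ mu = 0) \/ (be = -1 /\ be2 = 0) ->
  change_nondeg A B Q (al, be, be2, d, mu) ->
  coeff_change A B Q (al, be, be2, d, mu) (al', be', be2', d', mu') ->
  adapted n br (A *: x + B *: y) (Q *: y) al' be' be2' d' mu'.
Proof.
move=> [basis xtop vx xy x2y xky yy uy vy] cs [A0 Q0 p0 q0 r0] [h1 h2 h3 h4 h5].
set p := A + B * al in p0 h1 h5; set q := A + B * be2 in q0 h2 h5; set r := A + B * d in r0 h3 h4.
set x' := A *: x + B *: y; set y' := Q *: y.
set u := y ** x in xy yy uy x2y vx vy *; set v := u ** x in uy x2y vx vy *.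
have mulx' z : z ** x' = A *: (z ** x) + B *: (z ** y) by rewrite !brE.
pose P := A * p; pose S := B * (A + A * be + B * be2).
have u'E : y' ** x' = (Q * q) *: u.
  rewrite mulx' /y' !brE yy -/u !scalerA -scalerDl; congr (_ *: _); rewrite /q; ring.
have v'E : y' ** x' ** x' = (Q * q * r) *: v.
  rewrite u'E mulx' !brE uy -/v !scalerA -scalerDl; congr (_ *: _); rewrite /r; ring.
have x1E : x' ** x' = P *: (x ** x) + S *: u.
  rewrite mulx' /x' !brE xy yy -/u; have [L [LD LZ -> ->]] := plane_coordinates (x ** x) u.
  by rewrite !(LZ, LD); congr L; rewrite /P /S /p; ring.
have x2E : x' ** x' ** x' = (P * p) *: (x ** x ** x) + (P * B * (be - mu) + S * r) *: v.
  rewrite x1E mulx' !brE x2y uy -/v.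
  have [L [LD LZ -> ->]] := plane_coordinates (x ** x ** x) v.
  by rewrite !(LZ, LD); congr L; rewrite /p /r; ring.
have xkE k : rpow br x' x' k.+3 = (P * p ^+ k.+2) *: rpow br x x k.+3.
  elim: k => [|k IH].
    rewrite rpowS [rpow br x' x' 2]x2E mulx' !brE vx vy (xky 2 isT) !scaler0 !addr0.
    rewrite -[x ** x ** x ** x]/(rpow br x x 3) !scalerA -!scalerDl.
    congr (_ *: _); rewrite /p; ring.
  rewrite rpowS IH mulx' !brE xky // -rpowS !scalerA -scalerDl; congr (_ *: _).
  by rewrite [in RHS]exprSr /p; ring.
have al'E : al' = Q * al / p by rewrite -h1 mulrC mulKf.
have be2'E : be2' = Q * be2 / q by rewrite -h2 mulrC mulKf.
have d'E : d' = Q * d / r by rewrite -h3 mulrC mulKf.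
have mu'E : mu' = (A * mu + B * (be2 - d)) / r by rewrite -h4 mulrC mulKf.
have be'E : be' = A * (A * be + B * (be2 - al)) / (p * q).
  by rewrite -h5 mulrC mulKf // mulf_neq0.
split.
- rewrite basisEdim size_map size_iota dimV leqnn andbT -{1}(span_basis basis).
  set W := (<<[seq chain n br x' y' i | i <- iota 1 n]>>)%VS.
  have unscale (c : F) z : c != 0 -> c *: z \in W -> z \in W.
    by move=> c0 zW; rewrite -[z]scale1r -(mulVf c0) -scalerA memvZ.
  have xW k : (k < n - 3)%N -> rpow br x' x' k \in W.
    move=> kn; apply: memv_span; apply/mapP; exists k.+1; first by rewrite mem_iota; lia.
    by rewrite /chain kn.
  have yW k : (k < 3)%N -> rpow br x' y' k \in W.
    move=> kn; apply: memv_span; apply/mapP; exists (n - 2 + k)%N; first by rewrite mem_iota; lia.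
    by rewrite /chain ifN ?addKn //; lia.
  have y0W : y \in W by apply: (unscale Q) (yW 0%N isT).
  have uW : u \in W by apply: (unscale (Q * q)); rewrite ?mulf_neq0 // -u'E; apply: (yW 1%N).
  have vW : v \in W by apply: (unscale (Q * q * r)); rewrite ?mulf_neq0 // -v'E; apply: (yW 2).
  have xkW k : (k < n - 3)%N -> rpow br x x k \in W.
    case: k => [|[|[|k]]] kn.
    - apply: (unscale A) => //; rewrite -[A *: _](addrK (B *: y)) memvB ?memvZ //.
      exact: (xW 0%N).
    - apply: (unscale P); rewrite ?mulf_neq0 // -[P *: _](addrK (S *: u)) memvB ?memvZ //.
      by rewrite -x1E; apply: (xW 1%N).
    - apply: (unscale (P * p)); rewrite ?mulf_neq0 //.
      rewrite -[_ *: _](addrK ((P * B * (be - mu) + S * r) *: v)) memvB ?memvZ //.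
      by rewrite -x2E; apply: (xW 2).
    - apply: (unscale (P * p ^+ k.+2)); last by rewrite -xkE xW.
      by apply: mulf_neq0; [apply: mulf_neq0 | apply: expf_neq0].
  apply/span_subvP => _ /mapP[i + ->]; rewrite mem_iota /chain => iN.
  case: ifP => i3; first by apply: xkW; lia.
  have : (i - (n - 2) < 3)%N by lia.
  by case: (i - (n - 2))%N => [|[|[|]]].
- have -> : (n - 3)%N = (n - 6).+3 by lia.
  rewrite xkE; have -> : (n - 6).+3 = (n - 3)%N by lia.
  by rewrite xtop scaler0.
- by rewrite v'E mulx' !brE vx vy !scaler0 addr0.
- rewrite x1E u'E {1}/x' /y' !brE xy yy -/u.
  have [L [LD LZ -> ->]] := plane_coordinates (x ** x) u.
  rewrite !(LZ, LD); congr L; rewrite al'E ?be'E /P /S; move: p0 q0; rewrite /p /q => p0 q0; field; rewrite ?p0 ?q0 //.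
- rewrite x2E v'E x1E /y' !brE x2y uy -/v.
  have [L [LD LZ -> ->]] := plane_coordinates (x ** x ** x) v.
  rewrite !(LZ, LD); congr L; first by rewrite al'E /P; field.
  rewrite al'E be'E mu'E /P /S.
  case: cs => -[E1 E2]; move: p0 q0 r0; rewrite /p /q /r E1 E2 => p0 q0 r0; field; rewrite ?p0 ?q0 ?r0 ?A0 //.
- case=> [|[|[|k]]] // _.
    rewrite [rpow br x' x' 2]x2E /y' !brE vy (xky 2 isT) xkE !scaler0 addr0 !scalerA.
    by congr (_ *: _); rewrite al'E; field.
  rewrite !xkE /y' !brE xky // !scalerA; congr (_ *: _).
  by rewrite al'E [in RHS]exprSr; field.
- by rewrite u'E /y' !brE yy !scalerA; congr (_ *: _); rewrite be2'E; field.
- by rewrite v'E u'E /y' !brE uy !scalerA; congr (_ *: _); rewrite d'E; field.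
- by rewrite v'E /y' !brE vy !scaler0.
Qed.
End ChangeOfGenerators.

(** * Multiplication tables *)

(** One multiplication table covering all listed algebras, in terms of the tuple given by
    [coefficients] and of an arbitrary family [e] in place of the basis. *)
Definition ctable {F : fieldType} {W : lmodType F} (n : nat) (e : nat -> W)
    (c : F * F * F * F * F) (i j : nat) : W :=
  let: (al, be, be2, d, mu) := c in
  if j == 1%N then
    if (1 <= i <= n - 1)%N && (i != n - 3)%N then e i.+1 else 0
  else if j == (n - 2)%N then
    if i == 1%N then al *: e 2%N + be *: e (n - 1)%N
    else if i == 2%N then al *: e 3%N + (be - mu) *: e n
    else if (3 <= i <= n - 4)%N then al *: e i.+1
    else if i == (n - 2)%N then be2 *: e (n - 1)%N
    else if i == (n - 1)%N then d *: e n
    else 0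
  else if j == (n - 1)%N then
    if i == 1%N then mu *: e n
    else if i == (n - 2)%N then (be2 - d) *: e n
    else 0
  else 0.

Ltac decide_ifs := repeat match goal with
  | |- context [if ?b then _ else _] =>
    first [have -> : b = true by lia | have -> : b = false by lia] end.

Lemma table_ctable (F : fieldType) n (t : listed F) i j : (9 <= n)%N ->
  (0 < i <= n)%N -> (0 < j <= n)%N ->
  table n t i j = ctable n (@e_ F n) (coefficients t) i j.
Proof.
move=> n9 iN jN; rewrite /table.
have [j1|j1] := eqVneq j 1%N; first by case: t => *; rewrite /ctable /= j1.
have [j2|j2] := eqVneq j (n - 2)%N.
  have [i1|i1] := eqVneq i 1%N.
    by case: t => *; rewrite /ctable /=; decide_ifs; rewrite ?scale0r ?add0r ?addr0 ?scaleN1r ?scale1r.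
  have [i2|i2] := eqVneq i 2%N.
    case: t => *; rewrite /ctable /=; decide_ifs; rewrite ?subr0 ?scale0r ?add0r ?addr0 ?scale1r;
      by rewrite -?scaleNr ?opprD.
  have [i3|i3] := boolP (3 <= i <= n - 4)%N.
    by case: t => *; rewrite /ctable /=; decide_ifs; rewrite ?scale0r ?scale1r.
  have [i4|i4] := eqVneq i (n - 2)%N.
    have iS : i.+1 = (n - 1)%N by lia.
    by case: t => *; rewrite /ctable /=; decide_ifs; rewrite ?iS ?scale0r ?scale1r.
  have [i5|i5] := eqVneq i (n - 1)%N.
    have iS : i.+1 = n by lia.
    by case: t => *; rewrite /ctable /=; decide_ifs; rewrite ?iS ?scale0r ?scale1r ?scaleN1r.
  by case: t => *; rewrite /ctable /=; decide_ifs.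
have [j3|j3] := eqVneq j (n - 1)%N.
  have [i1|i1] := eqVneq i 1%N.
    by case: t => *; rewrite /ctable /=; decide_ifs; rewrite ?scale0r.
  have [i4|i4] := eqVneq i (n - 2)%N.
    case: t => *; rewrite /ctable /=; decide_ifs; rewrite ?subrr ?sub0r ?opprK ?scale0r ?scale1r //;
      by rewrite ?scaleN1r.
  by case: t => *; rewrite /ctable /=; decide_ifs.
by case: t => *; rewrite /ctable /=; decide_ifs.
Qed.

Lemma linear_ctable {F : fieldType} {V W : lmodType F} (f : {linear V -> W}) n
    (e : nat -> V) (e' : nat -> W) c i j : (9 <= n)%N -> (0 < i <= n)%N ->
  (forall k, (0 < k <= n)%N -> f (e k) = e' k) ->
  f (ctable n e c i j) = ctable n e' c i j.
Proof.
move=> n9 iN fe; case: c => -[[[al be] be2] d] mu; rewrite /ctable.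
repeat match goal with |- context [if ?b then _ else _] => case: (boolP b) => ? end;
  rewrite ?linear0 ?linearD ?linearZ /= ?fe //; lia.
Qed.

Section AdaptedTable.
Context {F : fieldType} {V : vectType F} {br : {bilinear V -> V -> V}}.
Local Notation "a ** b" := (br a b) (at level 40, left associativity).
Context {n : nat} (n9 : (9 <= n)%N) (leib : leibniz br).
Context {x y : V} {al be be2 d mu : F} (ad : adapted n br x y al be be2 d mu).
Let u := y ** x.
Let v := u ** x.
Local Notation "x ^: k" := (rpow br x x k) (at level 30).

Lemma adapted_xu : x ** u = mu *: v.
Proof.
rewrite leibD // (ad_xy ad) (ad_x2y ad) !brE -/u -/v opprD addrACA subrr add0r.
by rewrite -scalerBl opprB addrC subrK.
Qed.

Lemma adapted_yu : y ** u = (be2 - d) *: v.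
Proof. by rewrite leibD // (ad_yy ad) -/u (ad_uy ad) !brE scalerBl. Qed.

Lemma adapted_xku k : (0 < k)%N -> x ^: k ** u = 0.
Proof.
case: k => // -[|k] _; rewrite leibD //.
  rewrite -[rpow br x x 1 ** x]/(rpow br x x 2) (ad_xky ad (isT : 2 <= 2)%N).
  by rewrite [rpow br x x 1 ** y](ad_x2y ad) !brE (ad_ytop ad) scaler0 addr0 subrr.
rewrite -[rpow br x x k.+2 ** x]/(rpow br x x k.+3) !(ad_xky ad) //.
by rewrite linearZl_LR subrr.
Qed.

Lemma adapted_uu : u ** u = 0.
Proof. by rewrite leibD // (ad_uy ad) (ad_vy ad) !brE (ad_ytop ad) scaler0 subr0. Qed.

Lemma adapted_vu : v ** u = 0.
Proof. by rewrite leibD // (ad_vy ad) (ad_ytop ad) !brE subr0. Qed.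

Lemma adapted_rann_v : rann br v.
Proof.
have zv z : z ** v = z ** u ** x - z ** x ** u by apply: leibD.
have vx : v ** x = 0 := ad_ytop ad.
move=> z.
have zX : z \in <<in_tuple [seq chain n br x y i | i <- iota 1 n]>>%VS.
  by rewrite /= (span_basis (ad_basis ad)) memvf.
rewrite (coord_span zX) linear_sumlz big1 // => i _; rewrite linearZl_LR /=.
have /mapP[k kN ->] := mem_nth 0 (ltn_ord i); rewrite /chain mem_iota in kN *.
suff -> : (if (k <= n - 3)%N then x ^: k.-1 else rpow br x y (k - (n - 2))) ** v = 0.
  by rewrite scaler0.
case: ifP => kn.
  case: (k.-1) => [|j]; rewrite zv.
    by rewrite /= adapted_xu [x ** x ** u](@adapted_xku 1) // !brE vx scaler0 subrr.
  by rewrite -rpowS !adapted_xku // linear0l subrr.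
have : (k - (n - 2) < 3)%N by lia.
case: (k - (n - 2))%N => [|[|[|//]]] _; rewrite zv.
- by rewrite /= adapted_yu -/u adapted_uu !brE vx scaler0 subrr.
- by rewrite /= /rmul -/u -/v adapted_uu adapted_vu linear0l subrr.
- by rewrite /= /rmul -/u -/v adapted_vu vx !linear0l subrr.
Qed.

Lemma adapted_table i j : (0 < i <= n)%N -> (0 < j <= n)%N ->
  chain n br x y i ** chain n br x y j =
  ctable n (chain n br x y) (al, be, be2, d, mu) i j.
Proof.
move=> iN jN.
have cx k : (k < n - 3)%N -> chain n br x y k.+1 = x ^: k by rewrite /chain => ->.
have c1 : chain n br x y 1 = x by rewrite cx //; lia.
have c2 : chain n br x y 2 = x ** x by rewrite cx //; lia.
have c3 : chain n br x y 3 = x ** x ** x by rewrite cx //; lia.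
have cy : chain n br x y (n - 2) = y by rewrite /chain ifN ?subnn //; lia.
have cu : chain n br x y (n - 1) = u.
  by rewrite /chain ifN; [have -> : (n - 1 - (n - 2) = 1)%N by lia | lia].
have cv : chain n br x y n = v.
  by rewrite /chain ifN; [have -> : (n - (n - 2) = 2)%N by lia | lia].
have vx : v ** x = 0 := ad_ytop ad.
have iP : [\/ i = 1%N, i = 2%N, (3 <= i <= n - 3)%N | [\/ i = (n - 2)%N, i = (n - 1)%N | i = n]].
  have [|] := leqP i (n - 3).
    by case: i iN => [|[|[|i]]] // _ h; [constructor 1 | constructor 2 | constructor 3].
  move=> h; constructor 4; have : [|| i == n - 2, i == n - 1 | i == n]%N by lia.
  by case/or3P => /eqP; [constructor 1 | constructor 2 | constructor 3].
have [j1|j1] := eqVneq j 1%N.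
  rewrite j1 c1 /ctable /=.
  have [i3|i3] := ltnP i (n - 3).
    by case: i iN i3 {iP} => // i _ i3; decide_ifs; rewrite !cx //; lia.
  case: ifP => ic; last first.
    have : (i == n - 3)%N || (i == n) by lia.
    case/orP => /eqP ->; last by rewrite cv.
    have -> : (n - 3 = (n - 4).+1)%N by lia.
    rewrite cx; last by lia.
    by rewrite -rpowS (_ : (n - 4).+1 = n - 3)%N ?(ad_xtop ad) //; lia.
  have : (i == n - 2)%N || (i == n - 1)%N by lia.
  case/orP => /eqP ->.
    by rewrite cy (_ : (n - 2).+1 = n - 1)%N ?cu //; lia.
  by rewrite cu (_ : (n - 1).+1 = n)%N ?cv //; lia.
have [j2|j2] := eqVneq j (n - 2)%N.
  rewrite j2 cy /ctable; case: iP => [iE|iE|i3|[iE|iE|iE]]; try (rewrite iE; decide_ifs).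
  - by rewrite c1 c2 cu (ad_xy ad).
  - by rewrite c2 c3 cv (ad_x2y ad).
  - case: i iN i3 => // i iN i3; rewrite cx; last by lia.
    rewrite (ad_xky ad); last by lia.
    have [i4|i4] := eqVneq i.+1 (n - 3)%N; decide_ifs; last by rewrite cx //; lia.
    by rewrite i4 (ad_xtop ad) scaler0.
  - by rewrite cy cu (ad_yy ad).
  - by rewrite cu cv (ad_uy ad).
  - by rewrite cv (ad_vy ad).
have [j3|j3] := eqVneq j (n - 1)%N.
  rewrite j3 cu /ctable; case: iP => [iE|iE|i3|[iE|iE|iE]]; try (rewrite iE); decide_ifs.
  - by rewrite c1 cv adapted_xu.
  - by rewrite c2 -[x ** x]/(x ^: 1) adapted_xku.
  - by case: i iN i3 => // i iN i3; rewrite cx ?adapted_xku //; lia.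
  - by rewrite cy cv adapted_yu.
  - by rewrite cu adapted_uu.
  - by rewrite cv adapted_vu.
rewrite /ctable; decide_ifs.
have [jn|jn] := eqVneq j n; first by rewrite jn cv adapted_rann_v.
case: j jN j1 j2 j3 jn => [|[|j]] // jN _ j2 j3 jn; rewrite cx; last by lia.
have r k : rann br (x ^: k.+1).
  by elim: k => [|k IH]; [apply: rann_sqr | rewrite rpowS; apply: rann_mul].
exact: r.
Qed.

(** The isomorphism sends the basis formed by the two chains to the standard basis. *)
Lemma adapted_iso t : \dim {:V} = n -> coefficients t = (al, be, be2, d, mu) ->
  alg_iso br (@listed_bracket F n t).
Proof.
move=> dimV tE.
pose c := chain n br x y; pose X := [seq c i | i <- iota 1 n].
pose E := [seq @e_ F n i | i <- iota 1 n].
have rowE (z : 'rV[F]_n) : z = \sum_(i < n) z 0 i *: e_ F n i.+1.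
  apply/rowP => j; rewrite summxE (bigD1 j) //= !mxE eqxx mulr1 big1 ?addr0 // => i ij.
  by rewrite !mxE eqSS eq_sym (negPf (_ : (i : nat) != j)) ?mulr0.
have Efull : basis_of fullv E.
  rewrite basisEdim size_map size_iota dimvf /dim /= mul1n leqnn andbT.
  apply/subvP => z _; rewrite (rowE z); apply: memv_suml => i _; apply: memvZ.
  by apply/memv_span/map_f; rewrite mem_iota; have := ltn_ord i; lia.
have Xfull : basis_of fullv X := ad_basis ad.
have [f fE] := linear_of_free X E; have [g gE] := linear_of_free E X.
have sXE : size X = size E by rewrite !size_map.
have {}fE := fE (basis_free Xfull) (esym sXE).
have {}gE := gE (basis_free Efull) sXE.
have fc k : (0 < k <= n)%N -> f (c k) = e_ F n k.
  move=> kN; have := congr1 (fun s => nth 0 s k.-1) fE.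
  rewrite /E /X -map_comp !(nth_map 0%N) ?size_iota ?nth_iota; try lia.
  by rewrite add1n prednK //; lia.
have ge k : (0 < k <= n)%N -> g (e_ F n k) = c k.
  move=> kN; have := congr1 (fun s => nth 0 s k.-1) gE.
  rewrite /E /X -map_comp !(nth_map 0%N) ?size_iota ?nth_iota; try lia.
  by rewrite add1n prednK //; lia.
have fgK : cancel g f.
  move=> z; rewrite [in LHS](rowE z) !linear_sum [RHS](rowE z); apply: eq_bigr => i _.
  by rewrite !linearZ /= ge ?fc //; have := ltn_ord i; lia.
have gfK : cancel f g.
  move=> z; have zX : z \in <<in_tuple X>>%VS by rewrite /= (span_basis Xfull) memvf.
  rewrite (coord_span zX) !linear_sum; apply: eq_bigr => i _; rewrite !linearZ /=.
  have /mapP[k kN ->] := mem_nth 0 (ltn_ord i); rewrite mem_iota in kN.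
  by rewrite fc ?ge //; lia.
exists f; split; first by exists g.
have decomp a : a = \sum_(i < n) f a 0 i *: c i.+1.
  rewrite -[LHS]gfK [in LHS](rowE (f a)) linear_sum; apply: eq_bigr => i _.
  by rewrite linearZ /= ge //; have := ltn_ord i; lia.
move=> a b; rewrite [in LHS](decomp a) [in LHS](decomp b) linear_sumlz linear_sum.
apply: eq_bigr => i _; rewrite linear_sumr linear_sum; apply: eq_bigr => j _.
have iN : (0 < i.+1 <= n)%N by have := ltn_ord i; lia.
have jN : (0 < j.+1 <= n)%N by have := ltn_ord j; lia.
rewrite linearZl_LR linearZr_LR !linearZ /= scalerA; congr (_ *: _).
by rewrite adapted_table // (@linear_ctable _ _ _ f n c (e_ F n)) // table_ctable // tE.
Qed.
End AdaptedTable.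

(** * Coordinates of a product *)

Section Coordinates.
Context {F : fieldType} {n : nat} (n9 : (9 <= n)%N).

(** The coordinate of index [k], counted from 1 and with a natural number as index: it is
    zero outside the range, which avoids ordinals with computed values. *)
Definition entry (a : 'rV[F]_n) (k : nat) : F := \sum_(i < n) a 0 i * (i.+1 == k)%:R.

Lemma entryD a b k : entry (a + b) k = entry a k + entry b k.
Proof. by rewrite -big_split; apply: eq_bigr => i _; rewrite /= mxE mulrDl. Qed.

Lemma entryZ c a k : entry (c *: a) k = c * entry a k.
Proof. by rewrite mulr_sumr; apply: eq_bigr => i _; rewrite mxE mulrA. Qed.

Lemma entry0 k : entry 0 k = 0.
Proof. by rewrite /entry big1 // => i _; rewrite mxE mul0r. Qed.

Lemma entry_sum I (r : seq I) (G : I -> 'rV[F]_n) k :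
  entry (\sum_(i <- r) G i) k = \sum_(i <- r) entry (G i) k.
Proof. by apply: (big_morph (fun a => entry a k)) => [a b|]; [apply: entryD | apply: entry0]. Qed.

Lemma entryE (a : 'rV[F]_n) (i : 'I_n) : a 0 i = entry a i.+1.
Proof.
rewrite /entry (bigD1 i) //= eqxx mulr1 big1 ?addr0 // => j ji.
by rewrite eqSS (negPf (_ : (j : nat) != i)) ?mulr0.
Qed.

Lemma entry_inj (a b : 'rV[F]_n) : (forall k, (0 < k <= n)%N -> entry a k = entry b k) -> a = b.
Proof.
by move=> ab; apply/rowP => i; rewrite !entryE ab ?ltn_ord.
Qed.

Lemma entry_e i k : (0 < i <= n)%N -> entry (e_ F n i) k = (i == k)%:R.
Proof.
case: i => // i /= iN; rewrite /entry (bigD1 (Ordinal iN)) //= mxE eqxx mul1r.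
rewrite big1 ?addr0 // => j ji.
by rewrite mxE eqSS (negPf (_ : (j : nat) != i)) ?mul0r.
Qed.

Lemma sum_support (H : nat -> F) (r : seq nat) : uniq r ->
  {subset r <= index_iota 1 n.+1} ->
  (forall k, (0 < k <= n)%N -> k \notin r -> H k = 0) ->
  \sum_(i < n) H i.+1 = \sum_(k <- r) H k.
Proof.
move=> ur rn H0; have -> : \sum_(i < n) H i.+1 = \sum_(1 <= k < n.+1) H k.
  by rewrite big_add1 /= big_mkord.
rewrite (bigID [in r]) /= [X in _ + X]big_nat_cond [X in _ + X]big1 ?addr0; last first.
  by move=> k /andP[kn /H0]; apply.
rewrite -big_filter; apply: perm_big; apply: uniq_perm; rewrite ?filter_uniq ?iota_uniq //.
by move=> k; rewrite mem_filter; case: (boolP (k \in r)) => // /rn ->.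
Qed.

Section Product.
Context {t : listed F} {al be be2 d mu : F}.
Hypothesis tE : coefficients t = (al, be, be2, d, mu).
Local Notation T := (ctable n (@e_ F n) (al, be, be2, d, mu)).
Local Notation "a ** b" := (listed_bracket t a b) (at level 40, left associativity).

Lemma entry_mul a b m : entry (a ** b) m =
  \sum_(j <- [:: 1; n - 2; n - 1]%N) entry b j * \sum_(i < n) entry a i.+1 * entry (T i.+1 j) m.
Proof.
rewrite -(sum_support (H := fun j => entry b j * \sum_(i < n) entry a i.+1 * entry (T i.+1 j) m)).
- rewrite /listed_bracket entry_sum.
  under eq_bigr do rewrite entry_sum; rewrite exchange_big /=; apply: eq_bigr => j _.
  rewrite mulr_sumr; apply: eq_bigr => i _.
  have iN : (0 < i.+1 <= n)%N by have := ltn_ord i; lia.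
  have jN : (0 < j.+1 <= n)%N by have := ltn_ord j; lia.
  by rewrite entryZ table_ctable // tE !entryE mulrCA mulrA.
- by rewrite /= !inE; lia.
- by move=> k; rewrite !inE mem_index_iota; lia.
- move=> k kN kr; rewrite !inE in kr; rewrite big1 ?mulr0 // => i _.
  suff -> : T i.+1 k = 0 by rewrite entry0 mulr0.
  by rewrite /ctable; decide_ifs.
Qed.

Ltac entry_ctable := rewrite /ctable;
  repeat match goal with |- context [if ?b then _ else _] => case: (boolP b) => ? end;
  rewrite ?(entryD, entryZ, entry0) ?entry_e; try lia;
  repeat match goal with |- context [nat_of_bool ?b] =>
    first [have -> : b = true by lia | have -> : b = false by lia] end;
  rewrite /= ?(mulr0, mulr1, addr0, add0r).

Lemma sum_table a j m (r : seq nat) : uniq r -> {subset r <= index_iota 1 n.+1} ->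
  (forall k, (0 < k <= n)%N -> k \notin r -> entry (T k j) m = 0) ->
  \sum_(i < n) entry a i.+1 * entry (T i.+1 j) m = \sum_(k <- r) entry a k * entry (T k j) m.
Proof.
move=> ur rn T0; apply: (@sum_support (fun k => entry a k * entry (T k j) m)) => // k kn kr.
by rewrite T0 ?mulr0.
Qed.

Ltac support r := rewrite (@sum_table _ _ _ r);
  [ | by rewrite /= ?inE //; lia
  | by move=> ?; rewrite ?inE ?mem_index_iota //; lia
  | by move=> ? ?; rewrite ?inE => ?; entry_ctable].

(** Up to index [n - 3], the product by [b] shifts coordinates and multiplies them by the
    value at [b] of one linear form. *)
Lemma entry_mul_shift a b k : (0 < k <= n - 4)%N ->
  entry (a ** b) k.+1 = entry a k * (entry b 1%N + al * entry b (n - 2)%N).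
Proof.
move=> kn; rewrite entry_mul !big_cons big_nil.
support [:: k]. support [:: k]. support (@nil nat).
rewrite !big_cons !big_nil. entry_ctable; ring.
Qed.

Lemma entry_mul_top a b : entry (a ** b) 1%N = 0 /\ entry (a ** b) (n - 2)%N = 0.
Proof.
by split; rewrite entry_mul !big_cons big_nil; do 3!support (@nil nat);
  rewrite !big_nil; ring.
Qed.

Lemma entry_mul_u a b : entry (a ** b) (n - 1)%N = entry a (n - 2)%N * entry b 1%N +
  (be * entry a 1%N + be2 * entry a (n - 2)%N) * entry b (n - 2)%N.
Proof.
rewrite entry_mul !big_cons big_nil.
support [:: (n - 2)%N]. support [:: 1%N; (n - 2)%N]. support (@nil nat).
rewrite !big_cons !big_nil. entry_ctable; ring.
Qed.

Lemma entry_mul_v a b : entry (a ** b) n = entry a (n - 1)%N * entry b 1%N +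
  ((be - mu) * entry a 2%N + d * entry a (n - 1)%N) * entry b (n - 2)%N +
  (mu * entry a 1%N + (be2 - d) * entry a (n - 2)%N) * entry b (n - 1)%N.
Proof.
rewrite entry_mul !big_cons big_nil.
support [:: (n - 1)%N]. support [:: 2%N; (n - 1)%N]. support [:: 1%N; (n - 2)%N].
rewrite !big_cons !big_nil /ctable; decide_ifs.
have nS : (n - 1).+1 = n by lia.
rewrite nS !(entryD, entryZ, entry0) !entry_e; try lia.
have e1 : (n - 1 == n)%N = false by lia.
have e3 : (3 == n)%N = false by lia.
rewrite eqxx ?e1 ?e3 /=; ring.
Qed.
End Product.
End Coordinates.

(** * Isomorphisms between listed algebras *)

Lemma same_coefficients_same_algebra (F : fieldType) n (t t' : listed F) : (9 <= n)%N ->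
  coefficients t = coefficients t' -> same_algebra n t t'.
Proof.
move=> n9 tt' a b; apply: eq_bigr => i _; apply: eq_bigr => j _; congr (_ *: _).
have iN : (0 < i.+1 <= n)%N by have := ltn_ord i; lia.
have jN : (0 < j.+1 <= n)%N by have := ltn_ord j; lia.
by rewrite !table_ctable // tt'.
Qed.

Section Isomorphism.
Context {F : fieldType} {n : nat} (n9 : (9 <= n)%N) {t t' : listed F}.
Context {al be be2 d mu al' be' be2' d' mu' : F}.
Hypothesis tE : coefficients t = (al, be, be2, d, mu).
Hypothesis tE' : coefficients t' = (al', be', be2', d', mu').
Context (f : {linear 'rV[F]_n -> 'rV[F]_n}) (f_inj : injective f).
Local Notation "a ** b" := (listed_bracket t' a b) (at level 40, left associativity).
Hypothesis fM : forall a b, f (listed_bracket t a b) = f a ** f b.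

Let g k := f (e_ F n k).
Let X := g 1%N.
Let Y := g (n - 2)%N.
Let A := entry X 1%N.
Let B := entry X (n - 2)%N.
Let Q := entry Y (n - 2)%N.
Let p := A + B * al'.
Let q := A + B * be2'.
Let r := A + B * d'.

Lemma g_mul i j : (0 < i <= n)%N -> (0 < j <= n)%N ->
  g i ** g j = ctable n g (al, be, be2, d, mu) i j.
Proof.
move=> iN jN; rewrite -fM listed_bracketE // table_ctable // tE.
exact: (@linear_ctable _ _ _ f n (@e_ F n) g).
Qed.

Lemma g_next i : (0 < i <= n - 1)%N -> i != (n - 3)%N -> g i ** X = g i.+1.
Proof. by move=> iN i3; rewrite g_mul /ctable; try lia; decide_ifs. Qed.

Lemma g_neq0 k : (0 < k <= n)%N -> g k != 0.
Proof.
move=> kN; apply/negP => /eqP g0.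
have : entry (e_ F n k) k = 0 by rewrite (_ : e_ F n k = 0) ?entry0 //; apply: f_inj; rewrite linear0.
by rewrite entry_e // eqxx => /eqP; rewrite oner_eq0.
Qed.

Lemma entry_shift (a b : 'rV[F]_n) k : (0 < k <= n - 4)%N ->
  entry (a ** b) k.+1 = entry a k * (entry b 1%N + al' * entry b (n - 2)%N).
Proof. exact: entry_mul_shift tE' a b k. Qed.

Lemma entry_shiftX (a : 'rV[F]_n) k : (0 < k <= n - 4)%N -> entry (a ** X) k.+1 = entry a k * p.
Proof. by move=> kn; rewrite entry_shift // /p [al' * _]mulrC. Qed.

Lemma entry_top (a b : 'rV[F]_n) : entry (a ** b) 1%N = 0 /\ entry (a ** b) (n - 2)%N = 0.
Proof. exact: entry_mul_top tE' a b. Qed.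

Lemma entry_u (a b : 'rV[F]_n) : entry (a ** b) (n - 1)%N = entry a (n - 2)%N * entry b 1%N +
  (be' * entry a 1%N + be2' * entry a (n - 2)%N) * entry b (n - 2)%N.
Proof. exact: entry_mul_u tE' a b. Qed.

Lemma entry_v (a b : 'rV[F]_n) : entry (a ** b) n = entry a (n - 1)%N * entry b 1%N +
  ((be' - mu') * entry a 2%N + d' * entry a (n - 1)%N) * entry b (n - 2)%N +
  (mu' * entry a 1%N + (be2' - d') * entry a (n - 2)%N) * entry b (n - 1)%N.
Proof. exact: entry_mul_v tE' a b. Qed.

(** The image of [e_(k+1)] starts at index [k+1], with a coefficient that exhibits [A] and
    [p]; this is the leading term of a right power of [X]. *)
Lemma entry_power k : (k < n - 3)%N -> entry (g k.+1) k.+1 = A * p ^+ k /\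
  forall i, (0 < i <= n - 3)%N -> (i < k.+1)%N -> entry (g k.+1) i = 0.
Proof.
elim: k => [|k IH] kn; first by rewrite expr0 mulr1; split=> // -[].
have [|IH1 IH2] := IH; first by lia.
have gE : g k.+2 = g k.+1 ** X by rewrite g_next //; lia.
split; first by rewrite gE entry_shiftX ?IH1 ?exprSr ?mulrA //; lia.
move=> [|[|i]] // iN ik; first by rewrite gE; case: (entry_top (g k.+1) X).
by rewrite gE entry_shiftX ?IH2 ?mul0r //; lia.
Qed.

Lemma g_top : g (n - 3)%N = (A * p ^+ (n - 4)) *: e_ F n (n - 3)%N.
Proof.
have [|c1 c2] := @entry_power (n - 4); first by lia.
have top : (n - 4).+1 = (n - 3)%N by lia.
rewrite top in c1 c2.
have gE k : (2 <= k <= n - 3)%N -> g k = g k.-1 ** X.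
  by case: k => // k kn; rewrite g_next //; lia.
have gu k : (2 <= k <= n - 3)%N -> entry (g k) (n - 2)%N = 0.
  by move=> kn; rewrite gE //; case: (entry_top (g k.-1) X).
have g1 k : (2 <= k <= n - 3)%N -> entry (g k) 1%N = 0.
  by move=> kn; rewrite gE //; case: (entry_top (g k.-1) X).
have gn1 k : (3 <= k <= n - 3)%N -> entry (g k) (n - 1)%N = 0.
  by move=> kn; rewrite gE ?entry_u ?(gu k.-1) ?(g1 k.-1) ?(mulr0, mul0r, addr0) //; lia.
have g2 k : (3 <= k <= n - 3)%N -> entry (g k) 2%N = 0.
  by move=> kn; rewrite gE ?entry_shiftX ?(g1 k.-1) ?mul0r //; lia.
have gn : entry (g (n - 3)%N) n = 0.
  rewrite gE ?entry_v; last by lia.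
  have k3 : (3 <= (n - 3).-1 <= n - 3)%N by lia.
  by rewrite gn1 // g2 // (gu (n - 3).-1) ?(g1 (n - 3).-1) ?(mulr0, mul0r, addr0) //; lia.
apply: entry_inj => k kN; rewrite entryZ entry_e; last by lia.
have [<-|k3] := eqVneq (n - 3)%N k; first by rewrite mulr1 c1.
rewrite mulr0; have [kn|kn] := ltnP k (n - 3); first by apply: c2; lia.
have : [|| k == n - 2, k == n - 1 | k == n]%N by lia.
by case/or3P => /eqP ->; rewrite ?gu ?gn1 ?gn //; lia.
Qed.

Lemma A_neq0 : A != 0.
Proof.
have : g (n - 3)%N != 0 by apply: g_neq0; lia.
by apply: contraNneq => A0; rewrite g_top A0 mul0r scale0r.
Qed.

Lemma p_neq0 : p != 0.
Proof.
have : g (n - 3)%N != 0 by apply: g_neq0; lia.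
by apply: contraNneq => p0; rewrite g_top p0 expr0n (_ : (n - 4 == 0)%N = false) ?mulr0 ?scale0r //; lia.
Qed.

Lemma g_u : g (n - 1)%N = Y ** X.
Proof. by rewrite g_next; [congr g|..]; lia. Qed.

Lemma g_v : g n = Y ** X ** X.
Proof. by rewrite -g_u g_next; [congr g|..]; lia. Qed.

Lemma g_vX : Y ** X ** X ** X = 0.
Proof. by rewrite -g_v g_mul /ctable; try lia; decide_ifs. Qed.

(** The relation [Y X X X = 0] shifts the first coordinates of [Y] by three places and
    multiplies them by the nonzero [p ^ 3]. *)
Lemma Y_low k : (0 < k <= n - 6)%N -> entry Y k = 0.
Proof.
move=> kn; have : entry (Y ** X ** X ** X) k.+3 = 0 by rewrite g_vX entry0.
rewrite !entry_shiftX; try lia.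
by move/eqP; rewrite !mulf_eq0 !(negPf p_neq0) !orbF => /eqP.
Qed.

Lemma entry_YX : [/\ entry (Y ** X) 1%N = 0, entry (Y ** X) 2%N = 0, entry (Y ** X) (n - 2)%N = 0
  & entry (Y ** X) (n - 1)%N = Q * q].
Proof.
have [c1 c2] := entry_top Y X; have y1 : entry Y 1%N = 0 by apply: Y_low; lia.
split=> //; first by rewrite entry_shiftX ?y1 ?mul0r //; lia.
by rewrite entry_u y1 mulr0 add0r /q /Q -/A -/B; ring.
Qed.

Lemma entry_YXX : entry (Y ** X ** X) n = Q * q * r.
Proof.
have [c1 c2 c3 c4] := entry_YX; rewrite entry_v c1 c2 c3 c4 /r -/A -/B; ring.
Qed.

(** Otherwise the images of [e_n] and [e_(n-3)] would be proportional. *)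
Lemma Qqr_neq0 : Q * q * r != 0.
Proof.
apply/negP => /eqP Q0.
have [c1 c2 c3 c4] := entry_YX; have [c5 c6] := entry_top (Y ** X) X.
have gn : g n = entry (Y ** X ** X) (n - 3)%N *: e_ F n (n - 3)%N.
  rewrite g_v; apply: entry_inj => k kN; rewrite entryZ entry_e; last by lia.
  have [<-|k3] := eqVneq (n - 3)%N k; first by rewrite mulr1.
  rewrite mulr0; have [kn|kn] := ltnP k (n - 3).
    case: k kN k3 kn => [|[|[|k]]] // kN k3 kn.
      by rewrite entry_shiftX ?c1 ?mul0r //; lia.
    by rewrite !entry_shiftX ?Y_low ?mul0r //; lia.
  have : [|| k == n - 2, k == n - 1 | k == n]%N by lia.
  case/or3P => /eqP ->; rewrite ?entry_YXX //.
  by rewrite entry_u c1 c3 !mulr0 !mul0r addr0 mul0r add0r.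
pose c := entry (Y ** X ** X) (n - 3)%N / (A * p ^+ (n - 4)).
have cE : e_ F n n = c *: e_ F n (n - 3)%N.
  apply: f_inj; rewrite linearZ /= -[f (e_ F n n)]/(g n) -[f _]/(g (n - 3)%N).
  rewrite gn g_top scalerA divfK //.
  by rewrite mulf_neq0 ?expf_neq0 ?A_neq0 ?p_neq0.
have e1 : (n - 3 == n)%N = false by lia.
have n0 : (0 < n <= n)%N by lia.
have n3 : (0 < n - 3 <= n)%N by lia.
have := congr1 (fun a => entry a n) cE; rewrite entryZ !entry_e // e1 eqxx mulr0 => /eqP.
by rewrite oner_eq0.
Qed.

Lemma iso_nondeg : change_nondeg A B Q (al', be', be2', d', mu').
Proof.
move: Qqr_neq0; rewrite !mulf_eq0 !negb_or => /andP[/andP[Q0 q0] r0].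
split=> //; [exact: A_neq0 | exact: p_neq0].
Qed.

(** The five equations are the coordinates of the relations satisfied by the images of
    [e_1] and [e_(n-2)]: indices 2 and [n - 1] of [X Y], index [n - 1] of [Y Y], and
    index [n] of the products of [Y X] by [Y] and of [X] by [Y X]. *)
Lemma iso_coeff_change :
  coeff_change A B Q (al', be', be2', d', mu') (al, be, be2, d, mu).
Proof.
have [A0 Q0 p0 q0 r0] : [/\ A != 0, Q != 0, p != 0, q != 0 & r != 0] := iso_nondeg.
have [c1 c2 c3 c4] := entry_YX; have y1 : entry Y 1%N = 0 by apply: Y_low; lia.
have uE := g_u; have vE := g_v.
have x2 : g 2%N = X ** X by rewrite g_next //; lia.
have xy : X ** Y = al *: (X ** X) + be *: (Y ** X).
  by rewrite /X /Y g_mul /ctable; try lia; decide_ifs; rewrite x2 uE.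
have yy : Y ** Y = be2 *: (Y ** X).
  by rewrite {1 2}/Y g_mul /ctable; try lia; decide_ifs; rewrite uE.
have uy : Y ** X ** Y = d *: (Y ** X ** X).
  by rewrite -uE {1}/Y g_mul /ctable; try lia; decide_ifs; rewrite uE vE.
have xu : X ** (Y ** X) = mu *: (Y ** X ** X).
  by rewrite -uE {1}/X g_mul /ctable; try lia; decide_ifs; rewrite uE vE.
have h1 : p * al = Q * al'.
  have := congr1 (fun a => entry a 2%N) xy; rewrite entryD !entryZ c2 mulr0 addr0.
  rewrite entry_shift ?entry_shiftX ?y1 ?add0r; try lia.
  rewrite -/Q -/A => E; apply: (mulfI A0); rewrite [in RHS]mulrC.
  apply: (eq_scaled (k := -1) E); ring.
have h2 : q * be2 = Q * be2'.
  have := congr1 (fun a => entry a (n - 1)%N) yy; rewrite entryZ c4 entry_u y1 -/Q => E.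
  by apply: (mulfI Q0); apply: (eq_scaled (k := -1) E); ring.
have h3 : r * d = Q * d'.
  have := congr1 (fun a => entry a n) uy; rewrite entryZ entry_YXX entry_v c1 c2 c3 c4 y1 -/Q => E.
  by apply: (mulfI (mulf_neq0 Q0 q0)); apply: (eq_scaled (k := -1) E); ring.
have h4 : r * mu = A * mu' + B * (be2' - d').
  have := congr1 (fun a => entry a n) xu; rewrite entryZ entry_YXX entry_v c1 c3 c4 -/A -/B => E.
  by apply: (mulfI (mulf_neq0 Q0 q0)); apply: (eq_scaled (k := -1) E); ring.
split=> //.
have := congr1 (fun a => entry a (n - 1)%N) xy; rewrite entryD !entryZ c4 !entry_u y1 -/A -/B -/Q => E.
apply: (mulfI Q0); rewrite -/p -/q.
have -> : Q * (p * q * be) = p * (be * (Q * q)) by ring.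
have -> : be * (Q * q) = A * be' * Q + be2' * B * Q -
   al * (B * A + (be' * A + be2' * B) * B).
  by apply: (eq_scaled (k := -1) E); ring.
rewrite mulrBr mulrA h1 /p; ring.
Qed.
End Isomorphism.

(** * Classification *)

(** The possible values of the tuples of the listed algebras, grouped by the values of
    [al], [be2] and [d]. *)
Definition normal_coeff {F : fieldType} (c : F * F * F * F * F) : Prop :=
  let: (al, be, be2, d, mu) := c in
  [\/ [\/ [/\ al = 0, be2 = 0 & d = 0],
          [/\ al = 1, be2 = 0, d = 0 & be = -1 \/ be = 0 /\ mu = 0],
          [/\ al = 0, be2 = 1, d = 1 & mu = 0 /\ (be = 0 \/ be = 1)]
        | [/\ al = 1, be2 = 1, d = 1 & mu = 0 /\ (be = 0 \/ be = 1)]],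
      [/\ al = 1, be2 = 2, d = 2 & mu = 0],
      [/\ al = 0, be2 = 0, d = -1 & be = -1 /\ (mu = -1 \/ mu = 0)]
    | [\/ [/\ al = 1, be2 = 0, d = -1 & be = -1]
        | [/\ al = 1, be2 = 0, d = 1 & be = -1 /\ (mu = -1 \/ mu = 0)]]].

Lemma coefficients_normal (F : fieldType) (t : listed F) :
  admissible t -> normal_coeff (coefficients t).
Proof.
case: t => [l|m l|l|l|l|l|l m|l] /=; rewrite ?inE.
- by move=> _; do 2!constructor 1.
- case=> /orP[] /eqP -> /orP[] /eqP ->; constructor 1;
    by [constructor 3; split=> //; split=> //; auto | constructor 4; split=> //; split=> //; auto].
- by move=> /orP[] /eqP ->; constructor 1; constructor 2; split=> //; auto.
- by move=> _; constructor 2.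
- by move=> _; do 2!constructor 1.
- by move=> /orP[] /eqP ->; constructor 3; split=> //; split=> //; auto.
- move=> /orP[] /eqP ->; rewrite ?oppr0.
    by constructor 1; constructor 2; split=> //; auto.
  by constructor 4; constructor 1.
- by move=> /orP[] /eqP ->; constructor 4; constructor 2; split=> //; split=> //; auto.
Qed.

(** The rule preserves which of [al], [be2], [d] vanish, so only normal forms with the
    same pattern of zeros have to be compared: the eight diagonal cases, and the classes
    [al = 1] with [be2 = d] equal to 1 or 2, and with [be2 = 0] and [d] equal to 1
    or -1, against each other. *)
Lemma normal_coeff_rigid (F : numFieldType) (A B Q : F) c c' :
  normal_coeff c -> normal_coeff c' -> change_nondeg A B Q c -> coeff_change A B Q c c' ->
  c = c'.
Proof.
case: c => -[[[al be] be2] d] mu; case: c' => -[[[al' be'] be2'] d'] mu'.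
move=> nc nc' [A0 Q0 p0 q0 r0] [h1 h2 h3 h4 h5].
have Z (k z z' : F) : k != 0 -> k * z' = Q * z -> (z == 0) = (z' == 0).
  move=> k0 /(congr1 (fun w => w == 0)).
  by rewrite !mulf_eq0 (negPf k0) (negPf Q0).
have z1 := Z _ _ _ p0 h1; have z2 := Z _ _ _ q0 h2; have z3 := Z _ _ _ r0 h3.
have n20 : (2 == 0 :> F) = false by rewrite Num.Theory.pnatr_eq0.
have n10 : (1 == 0 :> F) = false by rewrite oner_eq0.
have nN0 : (-1 == 0 :> F) = false by rewrite oppr_eq0.
have absurd0 (z : F) : z != 0 -> 2 * z = 0 -> False.
  by move=> z0 /eqP; rewrite mulf_eq0 n20 (negPf z0).
have absurd2 (z w : F) : z != 0 -> w != 0 -> z * w = 0 -> False.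
  by move=> z0 w0 /eqP; rewrite mulf_eq0 (negPf z0) (negPf w0).
case: nc => [[[? ? ?]|[? ? ? H]|[? ? ? H]|[? ? ? H]]|[? ? ? H]|[? ? ? H]|[[? ? ? H]|[? ? ? H]]];
  case: nc' => [[[? ? ?]|[? ? ? H']|[? ? ? H']|[? ? ? H']]|[? ? ? H']|[? ? ? H']|[[? ? ? H']|[? ? ? H']]]; subst;
  move: z1 z2 z3; rewrite ?eqxx ?n20 ?n10 ?nN0 // => _ _ _.
- have -> : mu = mu' by apply: (mulfI A0); apply: (eq_scaled (k := -1) h4); ring.
  congr (_, _, _, _, _); apply: (mulfI (mulf_neq0 A0 A0)).
  by apply: (eq_scaled (k := -1) h5); ring.
- have -> : mu = mu' by apply: (mulfI A0); apply: (eq_scaled (k := -1) h4); ring.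
  case: H H' h5 => [->|[-> _]] [->|[-> _]] h5 //.
    by case: (absurd2 _ _ A0 p0); apply: (eq_scaled (k := 1) h5); ring.
  by case: (absurd2 _ _ A0 A0); apply: (eq_scaled (k := -1) h5); ring.
- case: H H' h5 => [-> [->|->]] [-> [->|->]] h5 //.
    by case: (absurd2 _ _ A0 A0); apply: (eq_scaled (k := 1) h5); ring.
  by case: (absurd2 _ _ A0 q0); apply: (eq_scaled (k := -1) h5); ring.
- case: H H' h5 => [-> [->|->]] [-> [->|->]] h5 //.
    by case: (absurd2 _ _ p0 p0); apply: (eq_scaled (k := 1) h5); ring.
  by case: (absurd2 _ _ A0 A0); apply: (eq_scaled (k := -1) h5); ring.
- have : Q = 0.
    have -> : Q = ((A + B * 1) * 2 - Q * 1) - 2 * ((A + B * 1) * 1 - Q * 1) by ring.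
    by rewrite h1 h2 !subrr mulr0 subr0.
  by move/eqP; rewrite (negPf Q0).
- have : A = 0.
    have -> : A = 2 * ((A + B * 1) * 1 - Q * 1) - ((A + B * 2) * 1 - Q * 2) by ring.
    by rewrite h1 h2 !subrr mulr0 subr0.
  by move/eqP; rewrite (negPf A0).
- have B0 : B = 0.
    apply/eqP/negP => /negP B0; apply: (absurd0 _ B0).
    have -> : 2 * B = ((A + B * 2) * 2 - Q * 2) - 2 * ((A + B * 1) * 1 - Q * 1) by ring.
    by rewrite h1 h2 !subrr mulr0 subr0.
  congr (_, _, _, _, _); apply: (mulfI (mulf_neq0 A0 A0)).
  by apply: (eq_scaled (k := -1) h5); rewrite B0; ring.
- case: H H' h4 => [-> [->|->]] [-> [->|->]] h4 //.
    by move/negP: r0; case; apply/eqP; apply: (eq_scaled (k := 1) h4); ring.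
  by move/negP: A0; case; apply/eqP; apply: (eq_scaled (k := -1) h4); ring.
- have B0 : B = 0.
    apply/eqP/negP => /negP B0; apply: (absurd0 _ B0).
    have -> : 2 * B = ((A + B * 1) * 1 - Q * 1) + ((A + B * -1) * -1 - Q * -1) by ring.
    by rewrite h1 h3 !subrr addr0.
  congr (_, _, _, _, _); apply: (mulfI A0).
  by apply: (eq_scaled (k := -1) h4); rewrite B0; ring.
- case: (absurd0 _ A0).
  have -> : 2 * A = ((A + B * 1) * 1 - Q * 1) + ((A + B * -1) * 1 - Q * -1) by ring.
  by rewrite h1 h3 !subrr addr0.
- case: (absurd0 _ Q0).
  have -> : 2 * Q = - ((A + B * 1) * 1 - Q * 1) - ((A + B * 1) * -1 - Q * 1) by ring.
  by rewrite h1 h3 !subrr oppr0 addr0.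
- case: H H' h4 => [-> [->|->]] [-> [->|->]] h4 //.
    by move/negP: r0; case; apply/eqP; apply: (eq_scaled (k := 1) h4); ring.
  by move/negP: A0; case; apply/eqP; apply: (eq_scaled (k := -1) h4); ring.
Qed.

Lemma iso_listed_coefficients (F : numFieldType) n (t t' : listed F) : (9 <= n)%N ->
  admissible t -> admissible t' ->
  alg_iso (@listed_bracket F n t) (@listed_bracket F n t') ->
  coefficients t = coefficients t'.
Proof.
move=> n9 a a' [f [[g fK _] fM]]; apply/esym.
have := coefficients_normal a; have := coefficients_normal a'.
case tE: (coefficients t) => [[[[al be] be2] d] mu].
case tE': (coefficients t') => [[[[al' be'] be2'] d'] mu'].
move=> na' na; apply: (normal_coeff_rigid na' na).
  exact: (iso_nondeg n9 tE tE' (can_inj fK) fM).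
exact: (iso_coeff_change n9 tE tE' (can_inj fK) fM).
Qed.

Lemma first_type_listed (F : numClosedFieldType) (V : vectType F)
    (br : {bilinear V -> V -> V}) n : (9 <= n)%N -> \dim {:V} = n ->
  leibniz br -> naturally_graded br -> first_type br n ->
  exists t : listed F, admissible t /\ alg_iso br (@listed_bracket F n t).
Proof.
move=> n9 dimV leib ngr ft.
have [x [y gc]] := first_type_chains n9 dimV leib ngr ft.
have [al [be [be2 [d [mu [ad cs]]]]]] := graded_chains_adapted n9 leib gc.
have [t [A [B [Q [adm nd cc]]]]] := exists_listed_coeff al cs.
exists t; split=> //; move: cc; case tE: (coefficients t) => [[[[al' be'] be2'] d'] mu'] cc.
exact: (adapted_iso n9 leib (adapted_change n9 dimV ad cs nd cc) dimV tE).
Qed.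

Theorem theorem2p2 (R : realType) (n : nat) (n_ge9 : (9 <= n)%N) :
  (forall (L : vectType (complex R)) (br : {bilinear L -> L -> L}),
      \dim {:L} = n ->
      leibniz br ->
      naturally_graded br ->
      charseq br [:: (n - 3)%N; 3%N] ->
      first_type br n ->
      exists t : listed (complex R),
        admissible t /\ alg_iso br (@listed_bracket (complex R) n t))
  /\
  (forall t t' : listed (complex R),
      admissible t -> admissible t' -> ~ same_algebra n t t' ->
      ~ alg_iso (@listed_bracket (complex R) n t) (@listed_bracket (complex R) n t')).
Proof.
split=> [L br dimL leib ngr _ ft|t t' a a' ntt' iso].
  exact: first_type_listed ft.
by apply: ntt'; apply: same_coefficients_same_algebra (iso_listed_coefficients _ a a' iso).
Qed.
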